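(* Let $Q = (-1/2, 1/2)^d \subset \mathbb{R}^d$ be the open unit cube and let $\Lambda \subseteq \mathbb{R}^d$ be a discrete set. Then $\Lambda$ is a spectrum of $Q$ if and only if $Q + \Lambda$ is a tiling of $\mathbb{R}^d$.
   Context: Spectrum: with $e_\lambda(x) = e^{2\pi i \langle \lambda, x\rangle}$, the set $\Lambda$ is a spectrum of a measurable set $\Omega\subset\mathbb{R}^d$ of measure $1$ if $E_\Lambda = \{e_\lambda : \lambda \in \Lambda\}$ is an orthonormal basis of $L^2(\Omega)$. Tiling: for a measurable set $E$ with indicator function $\mathbf{1}_E$, ''$E + \Lambda$ is a tiling'' means $\sum_{\lambda \in \Lambda} \mathbf{1}_E(x - \lambda) = 1$ for a.e. $x \in \mathbb{R}^d$. *)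

(* Defs.v *)
From HB Require Import structures.
From mathcomp Require Import all_boot all_order all_algebra.
From mathcomp Require Import all_classical all_reals all_analysis.
From mathcomp Require Import complex.

Set Implicit Arguments.
Unset Strict Implicit.
Unset Printing Implicit Defensive.
Import Order.TTheory GRing.Theory Num.Theory.
Import numFieldNormedType.Exports.

Local Open Scope classical_set_scope.
Local Open Scope ring_scope.

(* R^d is 'rV[R]_d, with the sigma-algebra generated by the coordinates (the
   Borel one), in the same way as the library does for n.-tuple T. *)
Section measurable_rV.
Context {R : realType} (n : nat).

Definition rV_coord (i : 'I_n) (x : 'rV[R]_n) : R := x ord0 i.

Let rV_set0 : g_sigma_preimage rV_coord set0.
Proof. exact: sigma_algebra0. Qed.

Let rV_setC A : g_sigma_preimage rV_coord A -> g_sigma_preimage rV_coord (~` A).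
Proof. exact: sigma_algebraC. Qed.

Let rV_bigcup (F : (set 'rV[R]_n)^nat) :
  (forall i, g_sigma_preimage rV_coord (F i)) ->
  g_sigma_preimage rV_coord (\bigcup_i (F i)).
Proof. exact: sigma_algebra_bigcup. Qed.

HB.instance Definition _ := @isMeasurable.Build default_measure_display
  'rV[R]_n (g_sigma_preimage rV_coord) rV_set0 rV_setC rV_bigcup.

Lemma measurable_rV_coord i : measurable_fun [set: 'rV[R]_n] (rV_coord i).
Proof.
move=> _ Y mY; rewrite setTI; apply: sub_sigma_algebra => /=.
rewrite -bigcup_seq/=; exists i => /=; first by rewrite mem_index_enum.
by exists Y => //; rewrite setTI.
Qed.

Lemma measurable_fun_rV d (T : measurableType d) (f : T -> 'rV[R]_n) :
  (forall i, measurable_fun [set: T] (rV_coord i \o f)) ->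
  measurable_fun [set: T] f.
Proof.
move=> mf _ A mA; rewrite setTI; move: A mA.
suff : @measurable _ 'rV[R]_n `<=` [set A | measurable (f @^-1` A)] by [].
apply: smallest_sub.
  split => /=.
  - by rewrite preimage_set0.
  - by move=> A mA; rewrite setTD preimage_setC; exact: measurableC.
  - by move=> F mF; rewrite preimage_bigcup; exact: bigcupT_measurable.
rewrite -bigcup_seq; apply: bigcup_sub => i _ A [B mB <-] /=.
by rewrite setTI -comp_preimage -[X in measurable X]setTI; exact: mf.
Qed.

End measurable_rV.

Section lebesgue_rV_rec.
Context {R : realType} (n : nat).
Local Open Scope ereal_scope.

Definition rV_cons (p : R * 'rV[R]_n) : 'rV[R]_n.+1 :=
  \row_i oapp (p.2 ord0) p.1 (unlift ord0 i).

Definition rV_behead (x : 'rV[R]_n.+1) : 'rV[R]_n :=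
  \row_i x ord0 (lift ord0 i).

Lemma rV_coord_behead x i : rV_coord i (rV_behead x) = rV_coord (lift ord0 i) x.
Proof. by rewrite /rV_coord mxE. Qed.

Lemma rV_coord_cons0 p : rV_coord ord0 (rV_cons p) = p.1.
Proof. by rewrite /rV_coord mxE unlift_none. Qed.

Lemma rV_coord_consS p i : rV_coord (lift ord0 i) (rV_cons p) = rV_coord i p.2.
Proof. by rewrite /rV_coord mxE liftK. Qed.

Lemma rV_consK p : rV_behead (rV_cons p) = p.2.
Proof. by apply/rowP => i; rewrite !mxE liftK. Qed.

Lemma measurable_rV_behead : measurable_fun [set: 'rV[R]_n.+1] rV_behead.
Proof.
apply: measurable_fun_rV => i.
rewrite (_ : _ \o _ = rV_coord (lift ord0 i)); first exact: measurable_rV_coord.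
by apply/funext => x /=; rewrite rV_coord_behead.
Qed.

Lemma measurable_rV_cons :
  measurable_fun [set: measurableTypeR R * 'rV[R]_n] rV_cons.
Proof.
apply: measurable_fun_rV => i; case: (unliftP ord0 i) => [j|] ->.
  rewrite (_ : _ \o _ = rV_coord j \o snd).
    exact: measurableT_comp (measurable_rV_coord j) measurable_snd.
  by apply/funext => p /=; rewrite rV_coord_consS.
rewrite (_ : _ \o _ = fst); first exact: measurable_fst.
by apply/funext => p /=; rewrite rV_coord_cons0.
Qed.

Variable mu : {sigma_finite_measure set 'rV[R]_n -> \bar R}.

Definition lebesgue_rV_succ (A : set 'rV[R]_n.+1) : \bar R :=
  ((@lebesgue_measure R) \x mu) (rV_cons @^-1` A).

Let succ0 : lebesgue_rV_succ set0 = 0.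
Proof. by rewrite /lebesgue_rV_succ preimage_set0 measure0. Qed.

Let succ_ge0 A : 0 <= lebesgue_rV_succ A.
Proof. exact: measure_ge0. Qed.

Let measurable_pre A : measurable A -> measurable (rV_cons @^-1` A).
Proof.
by move=> mA; rewrite -[X in measurable X]setTI; exact: measurable_rV_cons.
Qed.

Let succ_sigma_additive : semi_sigma_additive lebesgue_rV_succ.
Proof.
move=> F mF tF mUF; rewrite /lebesgue_rV_succ preimage_bigcup.
apply: measure_semi_sigma_additive.
- by move=> k; exact: measurable_pre.
- apply/trivIsetP => /= i j _ _ ij; rewrite -preimage_setI.
  by move/trivIsetP : tF => /(_ _ _ _ _ ij) ->//; rewrite preimage_set0.
- by rewrite -preimage_bigcup; exact: measurable_pre.
Qed.

HB.instance Definition _ := isMeasure.Build _ _ _ lebesgue_rV_succ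
  succ0 succ_ge0 succ_sigma_additive.

Let succ_sigma_finite : sigma_finite setT lebesgue_rV_succ.
Proof.
have [F FT Foo] := sigma_finiteT (@lebesgue_measure R).
have [G GT Goo] := sigma_finiteT mu.
pose box k l := rV_coord ord0 @^-1` F k `&` rV_behead @^-1` G l.
have pre k l : rV_cons @^-1` box k l = F k `*` G l.
  by apply/seteqP; split => -[x y];
    rewrite /box /= /preimage/= rV_coord_cons0 rV_consK.
exists (fun m => if unpickle m is Some (k, l) then box k l else set0).
  apply/esym; rewrite -subTset => x _.
  have [k _ Fk] : (\bigcup_k F k) (rV_coord ord0 x) by rewrite -FT.
  have [l _ Gl] : (\bigcup_l G l) (rV_behead x) by rewrite -GT.
  by exists (pickle (k, l)) => //; rewrite pickleK.
move=> m; case: (unpickle m) => [[k l]|]; last first.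
  by split; [exact: measurable0|rewrite measure0].
have [mF Fk] := Foo k; have [mG Gl] := Goo l.
split.
  apply: measurableI; rewrite -[X in measurable X]setTI.
    exact: measurable_rV_coord.
  exact: measurable_rV_behead.
rewrite /lebesgue_rV_succ pre product_measure1E//.
by apply: lte_mul_pinfty => //; rewrite ge0_fin_numE.
Qed.

HB.instance Definition _ :=
  @Measure_isSigmaFinite.Build _ _ _ lebesgue_rV_succ
  succ_sigma_finite.

End lebesgue_rV_rec.

(* Lebesgue measure on R^d as a d-fold product (R^0 is a point of mass 1). *)
Fixpoint lebesgue_rV {R : realType} (n : nat) :
    {sigma_finite_measure set 'rV[R]_n -> \bar R} :=
  match n with
  | 0 => [the {sigma_finite_measure set 'rV[R]_0 -> \bar R} of
              @dirac _ 'rV[R]_0 0 R]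
  | m.+1 => [the {sigma_finite_measure set 'rV[R]_m.+1 -> \bar R} of
              lebesgue_rV_succ (lebesgue_rV m)]
  end.

Section lebesgue_rV_box.
Context {R : realType}.
Local Open Scope ereal_scope.

Lemma measurable_rV_box n (A : 'I_n -> set R) :
  (forall i, measurable (A i)) ->
  measurable [set x : 'rV[R]_n | forall i, A i (x ord0 i)].
Proof.
move=> mA; rewrite (_ : mkset _ =
    \big[setI/setT]_(i < n) (rV_coord i @^-1` A i)).
  apply: big_rec => [|i B _ mB]; first exact: measurableT.
  apply: measurableI => //; rewrite -[X in measurable X]setTI.
  exact: measurable_rV_coord.
rewrite -bigcap_seq; apply/seteqP; split => x /= h i; first by move=> _; exact: h.
by apply: (h i); rewrite /= mem_index_enum.
Qed.

Lemma lebesgue_rV_box n (A : 'I_n -> set R) :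
  (forall i, measurable (A i)) ->
  lebesgue_rV n [set x : 'rV[R]_n | forall i, A i (x ord0 i)] =
  \big[mule/1]_(i < n) lebesgue_measure (A i).
Proof.
elim: n A => [|n IH] A mA.
  by rewrite big_ord0 /= diracE mem_set// => -[].
rewrite big_ord_recl -IH//.
have mB : measurable [set y : 'rV[R]_n | forall i, A (lift ord0 i) (y ord0 i)].
  by apply: (@measurable_rV_box _ (fun i => A (lift ord0 i))) => i; exact: mA.
transitivity ((lebesgue_measure \x lebesgue_rV n) (A ord0 `*`
    [set y : 'rV[R]_n | forall i, A (lift ord0 i) (y ord0 i)])).
  2: by apply: product_measure1E => //; exact: mA.
congr (product_measure1 _ _ _).
apply/seteqP; split => -[x y] /=.
  move=> h; split=> [|i]; first by have := h ord0; rewrite mxE unlift_none.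
  by have := h (lift ord0 i); rewrite mxE liftK.
move=> [Ax Ay] i; rewrite mxE; case: (unliftP ord0 i) => [j|] -> //=.
Qed.

End lebesgue_rV_box.

Section complex_L2.
Context d (T : measurableType d) (R : realType).
Variables (mu : {measure set T -> \bar R}) (D : set T).
Implicit Types f g : T -> R[i].

Definition cintegral f : R[i] :=
  Complex (\int[mu]_(x in D) complex.Re (f x))
          (\int[mu]_(x in D) complex.Im (f x)).

Definition L2_norm f : \bar R :=
  ((\int[mu]_(x in D) (ComplexField.Normc.normc (f x) ^+ 2)%:E) `^ 2^-1)%E.

(* Elements of L^2(D) are represented by functions T -> R[i], of which only the
   values on D matter; functions equal a.e. on D are not identified. *)
Definition L2 : set (T -> R[i]) := [set f |
  [/\ measurable_fun D (fun x => complex.Re (f x)),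
      measurable_fun D (fun x => complex.Im (f x)) &
      (L2_norm f < +oo)%E]].

Definition L2_inner f g : R[i] := cintegral (fun x => f x * conjc (g x)).

(* Orthonormal with dense linear span; all three clauses only depend on the
   classes modulo a.e. equality on D. *)
Definition orthonormal_basis (J : choiceType) (I : set J)
    (e : J -> T -> R[i]) : Prop :=
  [/\ forall i, I i -> L2 (e i),
      forall i j, I i -> I j -> L2_inner (e i) (e j) = (i == j)%:R &
      forall f, L2 f -> forall eps : R, 0 < eps ->
        exists (s : seq J) (c : J -> R[i]),
          (forall i, i \in s -> I i) /\
          (L2_norm (fun x => f x - \sum_(i <- s) c i * e i x)%R < eps%:E)%E].

End complex_L2.

Section spectra_and_tilings.
Context {R : realType} {d : nat}.

Definition rV_dot (u v : 'rV[R]_d) : R := \sum_i u ord0 i * v ord0 i.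

(* e^(2 pi i <l, x>) *)
Definition expo (l x : 'rV[R]_d) : R[i] :=
  Complex (cos (2 * pi * rV_dot l x)) (sin (2 * pi * rV_dot l x)).

Definition is_spectrum (Omega Lambda : set 'rV[R]_d) : Prop :=
  orthonormal_basis (lebesgue_rV d) Omega Lambda expo.

Definition is_tiling (E Lambda : set 'rV[R]_d) : Prop :=
  {ae lebesgue_rV d, forall x,
    (\esum_(l in Lambda) (\1_E (x - l)%R : R)%:E = 1)%E}.

Definition discrete_set (Lambda : set 'rV[R]_d) : Prop :=
  forall x, Lambda x -> isolated Lambda x.

Definition open_unit_cube : set 'rV[R]_d :=
  [set x | forall i, - 2^-1 < x ord0 i < 2^-1].

Lemma measurable_open_unit_cube : measurable open_unit_cube.
Proof.
rewrite (_ : open_unit_cube =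
    [set x | forall i, `]- 2^-1, 2^-1[%classic (x ord0 i)]).
  exact: (@measurable_rV_box R d (fun=> `]- 2^-1, 2^-1[%classic)).
by apply/seteqP; split => x /= h i; have := h i; rewrite in_itv.
Qed.

Lemma lebesgue_open_unit_cube : lebesgue_rV d open_unit_cube = 1%E.
Proof.
rewrite (_ : open_unit_cube =
    [set x | forall i, `]- 2^-1, 2^-1[%classic (x ord0 i)]).
  rewrite (@lebesgue_rV_box R d (fun=> `]- 2^-1, 2^-1[%classic))//.
  rewrite big1// => i _; rewrite lebesgue_measure_itv/= lte_fin.
  rewrite gtrN ?invr_gt0// -EFinB opprK [X in X%:E](_ : _ = 1)//.
  by rewrite [RHS](splitr 1) div1r.
by apply/seteqP; split => x /= h i; have := h i; rewrite in_itv.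
Qed.

End spectra_and_tilings.

(* Main.v *)
Require Import Defs.
From mathcomp Require Import all_boot all_order all_algebra.
From mathcomp Require Import all_classical all_reals all_analysis.
From mathcomp Require Import measurable_realfun.
From mathcomp Require Import complex.
From mathcomp Require Import ring lra zify.

(* Write [sinc v] for the integral of [e^(2 pi i v t)] over (-1/2, 1/2) and [G] for the
   product of the [sinc]s of the coordinates, so that <e_u, e_v> = G (u - v) in L^2(Q).
   By Parseval's identity for the exponentials e_v, together with the density of
   trigonometric polynomials in L^2(Q), L is a spectrum of Q if and only if
   sum_(l in L) G (v - l)^2 = 1 for all v.  For L = Z^d this holds unconditionally.

   Tiling => spectrum.  The tiling identity is sum_(l in L) prod_i f (x_i - l_i) = 1 with
   f the indicator of [-1/2, 1/2), and the goal is the same identity with f = sinc^2.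
   One exchanges the factors coordinate by coordinate: a discrete measure on R that
   gives mass 1 to every window (t, t + 1] is 1-periodic, and its convolution with
   any h such that sum_(k in Z) h (t - k) = 1 is 1.  No appeal to Keller's theorem on
   cube tilings is needed.

   Spectrum => tiling (after Kolountzakis).  Orthogonality forces two frequencies to
   differ by a nonzero integer in some coordinate, so that the translates of Q are
   disjoint: F = sum_(l in L) 1_Q (. - l) is at most 1.  Moreover the integral of F G^2 is
   the integral over Q of sum_(l in L) G (. + l)^2 = 1, while the integral of G^2 is at
   most 1.  Hence (1 - F) G^2 = 0 almost everywhere, and G vanishes on a null set only. *)

Set Implicit Arguments.
Unset Strict Implicit.
Unset Printing Implicit Defensive.
Import Order.TTheory GRing.Theory Num.Theory.
Import numFieldNormedType.Exports.

Local Open Scope classical_set_scope.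
Local Open Scope ring_scope.

(** * Translation invariance of Lebesgue measure on row vectors *)

Section translation.
Context {R : realType}.

(** The pushforward under the translation gives half-open intervals their length, and Lebesgue
    measure is the only measure that does. *)
Lemma lebesgue_measure_shift (v : R) (A : set R) : measurable A ->
  lebesgue_measure ((fun x => x + v) @^-1` A) = lebesgue_measure A.
Proof.
move=> mA; pose f := (fun x => x + v : measurableTypeR R).
have mf : measurable_fun [set: measurableTypeR R] f by exact: measurable_funD.
have H := @lebesgue_measure_unique R
  (measure_function_pushforward__canonical__measure_function_Measure lebesgue_measure mf).
apply/esym; apply: H => // _ [[a b]] _ <-; rewrite /= /pushforward.
rewrite (_ : f @^-1` _ = `]a - v, b - v]%classic); last first.
  by apply/seteqP; split => x; rewrite /f /= !in_itv/= ltrBlDr lerBrDr.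
rewrite !lebesgue_measure_itv/= !lte_fin ltrD2r.
by case: ifP => // _; congr (_%:E); ring.
Qed.

Lemma measurable_rV_shift n (v : 'rV[R]_n) :
  measurable_fun [set: 'rV[R]_n] (fun x : 'rV[R]_n => x + v).
Proof.
apply: measurable_fun_rV => i.
rewrite (_ : _ \o _ = (fun x => rV_coord i x + v ord0 i)); last first.
  by apply/funext => x; rewrite /rV_coord/= mxE.
by apply: measurable_funD => //; exact: measurable_rV_coord.
Qed.

(** Induction on the dimension: the translated product measure has the right value on rectangles,
    and these determine a product of sigma-finite measures. *)
Lemma lebesgue_rV_shift n (v : 'rV[R]_n) (A : set 'rV[R]_n) : measurable A ->
  lebesgue_rV n ((fun x => x + v) @^-1` A) = lebesgue_rV n A.
Proof.
elim: n v A => [|n IH] v A mA.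
  by congr (lebesgue_rV 0 _); apply/seteqP; split => x /=; rewrite !thinmx0.
pose m := ((@lebesgue_measure R) \x (lebesgue_rV n))%E.
pose w : 'rV[R]_n := rV_behead v.
pose f (p : measurableTypeR R * 'rV[R]_n) : measurableTypeR R * 'rV[R]_n :=
  (p.1 + v ord0 ord0, p.2 + w).
have mf : measurable_fun [set: measurableTypeR R * 'rV[R]_n] f.
  apply/measurable_fun_pairP; split => /=.
    by apply: measurable_funD => //; exact: measurable_fst.
  exact: (measurableT_comp (measurable_rV_shift w) measurable_snd).
have mc : measurable (@rV_cons R n @^-1` A).
  by rewrite -[X in measurable X]setTI; exact: measurable_rV_cons.
transitivity (pushforward m f (@rV_cons R n @^-1` A)).
  rewrite /= /lebesgue_rV_succ /pushforward; congr (m _).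
  have E p : rV_cons (f p) = rV_cons p + v.
    apply/rowP => i; rewrite !mxE; case: unliftP => [j|] -> //=.
    by rewrite !mxE.
  by apply/seteqP; split => p /=; rewrite E.
change (pushforward m f (@rV_cons R n @^-1` A) = m (@rV_cons R n @^-1` A)).
have H := @product_measure_unique _ _ _ _ _ (@lebesgue_measure R) (lebesgue_rV n)
  (measure_function_pushforward__canonical__measure_function_Measure m mf).
apply/esym; refine (H _ _ mc) => B C mB mC.
change (m ((fun x => x + v ord0 ord0)%R @^-1` B `*` (fun x => x + w)%R @^-1` C) =
  lebesgue_measure B * lebesgue_rV n C)%E.
have mD : measurable
    ((fun x : measurableTypeR R => x + v ord0 ord0 : measurableTypeR R) @^-1` B).
  have : measurable_fun [set: measurableTypeR R]
      (fun x : measurableTypeR R => x + v ord0 ord0 : measurableTypeR R).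
    exact: measurable_funD.
  by move=> /(_ measurableT B mB); rewrite setTI.
have mE : measurable ((fun x => x + w) @^-1` C).
  by rewrite -[X in measurable X]setTI; exact: measurable_rV_shift.
rewrite [LHS]product_measure1E//.
by rewrite -(IH w) // -(lebesgue_measure_shift (v ord0 ord0)).
Qed.

Lemma ge0_integral_rV_shift n (v : 'rV[R]_n) (f : 'rV[R]_n -> \bar R) D :
  measurable D -> measurable_fun D f -> (forall x, D x -> 0 <= f x)%E ->
  (\int[lebesgue_rV n]_(x in (fun x => (x + v)%R) @^-1` D) f (x + v)%R =
   \int[lebesgue_rV n]_(x in D) f x)%E.
Proof.
move=> mD mf f0.
transitivity (\int[pushforward (lebesgue_rV n) (fun x : 'rV[R]_n => x + v)%R]_(x in D)
    f x)%E.
  rewrite ge0_integral_pushforward//; last by move=> x /[!inE]; exact: f0.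
  exact: measurable_rV_shift.
have ms := measurable_rV_shift v.
apply: (@eq_measure_integral _ _ _ _ _
  (measure_function_pushforward__canonical__measure_function_Measure (lebesgue_rV n) ms)).
by move=> A mA _; exact: (lebesgue_rV_shift v mA).
Qed.

End translation.

(** * Exponentials on the unit cube *)

Section cube_integrals.
Context {R : realType}.

(** Division by 0 yields 0 here, so the limit value 1 at the origin is set by hand. *)
Definition sinc (v : R) : R := if v == 0 then 1 else sin (pi * v) / (pi * v).

Lemma sinc0 : sinc 0 = 1.
Proof. by rewrite /sinc eqxx. Qed.

Lemma sincN v : sinc (- v) = sinc v.
Proof. by rewrite /sinc oppr_eq0 mulrN sinN invrN mulrNN. Qed.

Local Notation I := (`](- 2^-1), 2^-1[%classic : set R).

Lemma is_derive_sin_affine (a c t : R) :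
  is_derive t 1 (fun x => sin (a + c * x)) (c * cos (a + c * t)).
Proof.
have h : is_derive t 1 (fun x => a + c * x) c.
  have := is_deriveD (is_derive_cst a t 1) (is_deriveZ c (is_derive_id t (1 : R))).
  by rewrite add0r /GRing.scale/= mulr1.
have := @is_derive1_comp _ sin (fun x => a + c * x) t _ _ (is_derive_sin _) h.
by rewrite mulrC.
Qed.

(** Fundamental theorem of calculus with [c = 2 pi v]: the increment
    [sin (a + c / 2) - sin (a - c / 2)] is [2 cos a sin (pi v)]. The antiderivative divides by [c],
    so [v = 0] is treated apart. *)
Lemma integral_cos_affine (a v : R) :
  (\int[lebesgue_measure]_(x in I) (cos (a + 2 * pi * v * x))%:E =
   (cos a * sinc v)%:E)%E.
Proof.
have [->|v0] := eqVneq v 0.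
  under eq_integral => x _ do rewrite mulr0 mul0r addr0.
  rewrite integral_cst//= lebesgue_measure_itv/= lte_fin.
  by rewrite gtrN ?invr_gt0// -EFinB -EFinM sinc0; congr (_ * _)%:E; lra.
have pi_neq0 : pi != 0 :> R by rewrite gt_eqF// pi_gt0.
pose c := 2 * pi * v; have c0 : c != 0 by rewrite !mulf_neq0.
pose F x := c^-1 * sin (a + c * x).
have dF (x : R) : is_derive x 1 F (cos (a + c * x)).
  have := is_deriveZ c^-1 (is_derive_sin_affine a c x).
  by rewrite /GRing.scale/= mulrA mulVf// mul1r.
have cF : continuous F.
  by move=> x; apply/differentiable_continuous/derivable1_diffP; case: (dF x).
have cf : continuous (fun x => cos (a + c * x)).
  move=> x; apply: (@continuous_comp _ _ _ (fun x => a + c * x) cos).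
    apply: cvgD; first exact: cvg_cst.
    by apply: cvgM; [exact: cvg_cst|exact: cvg_id].
  exact: continuous_cos.
have h2 : - 2^-1 < 2^-1 :> R by rewrite gtrN.
rewrite -/c -(@integral_itv_bndoo _ _ _ _ true false); last first.
  apply/measurable_EFinP; apply: measurable_funTS.
  exact: continuous_measurable_fun.
rewrite (@continuous_FTC2 _ (fun x => cos (a + c * x)) F)//.
- rewrite -EFinB /F -mulrBr; congr (_%:E).
  rewrite mulrN (_ : c * 2^-1 = pi * v); last by rewrite /c; field.
  rewrite /sinc (negPf v0) sinB sinD.
  have key (p s k u : R) : p != 0 ->
      (2 * p * v)^-1 * (u + k * s - (u - k * s)) = k * (s / (p * v)).
    by move=> p0; field; rewrite v0.
  exact: key.
- by apply: continuous_subspaceT; exact: cf.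
- split.
  + by move=> x _; case: (dF x).
  + by apply: cvg_at_right_filter; exact: cF.
  + by apply: cvg_at_left_filter; exact: cF.
- by move=> x _; rewrite derive1E; have [_] := dF x.
Qed.


(** The function [G] of the overview: the Fourier transform of the indicator of the cube. *)
Definition cube_sinc n (v : 'rV[R]_n) : R := \prod_(i < n) sinc (v ord0 i).

Local Notation Q n := (@open_unit_cube R n).

Lemma cube_sinc0 n : cube_sinc (0 : 'rV[R]_n) = 1.
Proof. by rewrite /cube_sinc big1// => i _; rewrite mxE sinc0. Qed.

Lemma cube_sincN n (v : 'rV[R]_n) : cube_sinc (- v) = cube_sinc v.
Proof. by apply: eq_bigr => i _; rewrite mxE sincN. Qed.

Lemma lebesgue_open_unit_cube_lty n : (lebesgue_rV n (Q n) < +oo)%E.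
Proof. by rewrite lebesgue_open_unit_cube ltry. Qed.

Lemma integral_open_unit_cubeS n (f : 'rV[R]_n.+1 -> R) :
  measurable_fun [set: 'rV[R]_n.+1] f -> [bounded f x | x in Q n.+1] ->
  (\int[lebesgue_rV n.+1]_(x in Q n.+1) (f x)%:E =
   \int[lebesgue_measure]_(t in I) \int[lebesgue_rV n]_(y in Q n)
      (f (rV_cons (t, y)))%:E)%E.
Proof.
move=> mf bf.
have mQ k : measurable (Q k) by exact: measurable_open_unit_cube.
have intf : (lebesgue_rV n.+1).-integrable (Q n.+1) (EFin \o f).
  apply: measurable_bounded_integrable bf; [exact: mQ|exact: lebesgue_open_unit_cube_lty|].
  exact: measurable_funTS.
(* Extension by zero moves the integral to the whole space, where the pushforward and Fubini
   theorems apply; the two nested domains are read off again at the end. *)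
pose g : 'rV[R]_n.+1 -> \bar R := (EFin \o f) \_ (Q n.+1).
have intg : (lebesgue_rV n.+1).-integrable setT g.
  exact: (integrable_mkcond _ (mQ _)).1 intf.
have mg : measurable_fun [set: 'rV[R]_n.+1] g by exact: measurable_int intg.
rewrite integral_mkcond -/g.
pose m := ((@lebesgue_measure R) \x (lebesgue_rV n))%E.
have mc := @measurable_rV_cons R n.
have intm : m.-integrable setT (g \o @rV_cons R n).
  apply/integrableP; split; first exact: measurableT_comp.
  case/integrableP : intg => _; apply: le_lt_trans.
  rewrite -[X in (X <= _)%E](@ge0_integral_pushforward _ _ _ _ _ _ mc m setT
    (fun x => `|g x|)%E)//.
  exact: measurableT_comp.
transitivity (\int[m]_p (g (rV_cons p)))%E.
  exact: (integral_pushforward mc mg intm measurableT).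
transitivity (\int[lebesgue_measure]_t \int[lebesgue_rV n]_y g (rV_cons (t, y)))%E.
  by rewrite -(integral12_prod_meas1 intm).
rewrite [RHS]integral_mkcond; apply: eq_integral => t _.
rewrite /patch; case: ifPn => tI.
  rewrite [RHS]integral_mkcond; apply: eq_integral => y _.
  rewrite /g /patch; congr (if _ then _ else _).
  apply/idP/idP; rewrite !inE => h.
    by move=> i; have := h (lift ord0 i); rewrite mxE liftK.
  move=> i; rewrite mxE; case: unliftP => [j|] _ //=.
  by move: tI; rewrite inE/= in_itv.
rewrite integral0_eq// => y _; rewrite /g /patch ifF//.
apply/negbTE; apply: contra tI; rewrite !inE/= in_itv/= => /(_ ord0).
by rewrite mxE unlift_none.
Qed.

Lemma rV_dot_cons n (v : 'rV[R]_n.+1) t y :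
  rV_dot v (rV_cons (t, y)) = v ord0 ord0 * t + rV_dot (rV_behead v) y.
Proof.
rewrite /rV_dot big_ord_recl mxE unlift_none/=; congr (_ + _).
by apply: eq_bigr => i _; rewrite !mxE liftK.
Qed.

Lemma measurable_rV_dot n (v : 'rV[R]_n) : measurable_fun setT (rV_dot v).
Proof.
apply: measurable_sum => i; apply: measurable_funM => //.
exact: measurable_rV_coord.
Qed.

Lemma measurable_cos_rV_dot n (a b : R) (v : 'rV[R]_n) :
  measurable_fun setT (fun x => cos (a + b * rV_dot v x)).
Proof.
apply: measurableT_comp.
  by apply: continuous_measurable_fun; exact: continuous_cos.
apply: measurable_funD => //; apply: measurable_funM => //.
exact: measurable_rV_dot.
Qed.

(* The phase [a] makes the induction on the dimension go through with cosines only; the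
   value [a = - pi / 2] covers the sines. *)
Lemma integral_cos_rV_dot n (a : R) (v : 'rV[R]_n) :
  (\int[lebesgue_rV n]_(x in Q n) (cos (a + 2 * pi * rV_dot v x))%:E =
   (cos a * cube_sinc v)%:E)%E.
Proof.
elim: n a v => [|n IH] a v.
  under eq_integral => x _ do rewrite /rV_dot big_ord0 mulr0 addr0.
  rewrite integral_cst; last exact: measurable_open_unit_cube.
  have := @lebesgue_open_unit_cube R 0; rewrite /= => ->.
  by rewrite mule1 /cube_sinc big_ord0 mulr1.
rewrite integral_open_unit_cubeS//; last 2 first.
- exact: measurable_cos_rV_dot.
- by exists 1; split => // M M1 x _ /=; rewrite (le_trans (cos_max _))// ltW.
transitivity (\int[lebesgue_measure]_(t in I)
    ((cube_sinc (rV_behead v))%:E * (cos (a + 2 * pi * v ord0 ord0 * t))%:E))%E.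
  apply: eq_integral => t _.
  under eq_integral => y _ do rewrite rV_dot_cons mulrDr addrA.
  by rewrite IH mulrA -EFinM mulrC.
rewrite integralZl//; last first.
  apply: measurable_bounded_integrable => //=.
  - by rewrite lebesgue_measure_itv/= lte_fin gtrN ?invr_gt0// -EFinB ltry.
  - apply: measurable_funTS; apply: measurableT_comp.
      by apply: continuous_measurable_fun; exact: continuous_cos.
    by apply: measurable_funD => //; exact: measurable_funM.
  - by exists 1; split => // M M1 x _ /=; rewrite (le_trans (cos_max _))// ltW.
rewrite integral_cos_affine -EFinM /cube_sinc big_ord_recl; congr _%:E.
rewrite mulrC -mulrA; congr (_ * (_ * _)).
by apply: eq_bigr => i _; rewrite mxE.
Qed.

End cube_integrals.

(** * Integrals and energies of trigonometric polynomials over the cube *)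

Section trigonometric_polynomials.
Context {R : realType} {n : nat}.
Local Notation Q := (@open_unit_cube R n).
Local Notation mu := (lebesgue_rV n).
Local Notation Re := complex.Re.
Local Notation Im := complex.Im.
Local Notation normc := ComplexField.Normc.normc.
Implicit Types (u v : 'rV[R]_n) (f g : 'rV[R]_n -> R[i]).

Lemma sqr_normc_Re_Im (z : R[i]) : normc z ^+ 2 = Re z ^+ 2 + Im z ^+ 2.
Proof. by case: z => a b /=; rewrite sqr_sqrtr// addr_ge0// sqr_ge0. Qed.

Lemma sqr_normc_Re_conj (z : R[i]) : normc z ^+ 2 = Re (z * conjc z).
Proof. by rewrite sqr_normc_Re_Im; case: z => a b /=; ring. Qed.

Lemma Re_sum I (r : seq I) (F : I -> R[i]) :
  Re (\sum_(i <- r) F i) = \sum_(i <- r) Re (F i).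
Proof. by elim/big_rec2: _ => // i _ z _ <-; case: (F i); case: z. Qed.

Lemma rV_dotB u v x : rV_dot (u - v) x = rV_dot u x - rV_dot v x.
Proof.
rewrite /rV_dot -sumrB; apply: eq_bigr => i _; by rewrite !mxE mulrBl.
Qed.

Lemma rV_dotD u v x : rV_dot (u + v) x = rV_dot u x + rV_dot v x.
Proof.
rewrite /rV_dot -big_split; apply: eq_bigr => i _; by rewrite !mxE mulrDl.
Qed.

Lemma expoD u v x : expo (u + v) x = expo u x * expo v x.
Proof.
rewrite /expo rV_dotD mulrDr cosD sinD; apply/eqP; rewrite eq_complex/=.
by rewrite eqxx/= addrC mulrC; apply/eqP; ring.
Qed.

Lemma expoN u x : expo (- u) x = conjc (expo u x).
Proof.
have : rV_dot (- u) x = - rV_dot u x.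
  by rewrite -[- u]add0r rV_dotB /rV_dot big1 ?sub0r// => i _; rewrite mxE mul0r.
by rewrite /expo => ->; rewrite mulrN cosN sinN.
Qed.

Lemma expo0 x : expo (0 : 'rV[R]_n) x = 1.
Proof.
rewrite /expo /rV_dot big1 => [|i _]; last by rewrite mxE mul0r.
by rewrite mulr0 cos0 sin0.
Qed.

Lemma normc_expo u x : normc (expo u x) = 1.
Proof. by rewrite /expo/= cos2Dsin2 sqrtr1. Qed.

Definition cintegrable f :=
  mu.-integrable Q (fun x => (Re (f x))%:E) /\
  mu.-integrable Q (fun x => (Im (f x))%:E).

Let mQ : measurable Q := measurable_open_unit_cube.

Lemma measurable_Re_expo v : measurable_fun setT (fun x => Re (expo v x)).
Proof.
apply: eq_measurable_fun (measurable_cos_rV_dot 0 (2 * pi) v).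
by move=> x _; rewrite add0r.
Qed.

Lemma measurable_Im_expo v : measurable_fun setT (fun x => Im (expo v x)).
Proof.
apply: eq_measurable_fun (measurable_cos_rV_dot (- (pi / 2)) (2 * pi) v).
by move=> x _; rewrite addrC cosBpihalf.
Qed.

Lemma integrable_bounded_cube (f : 'rV[R]_n -> R) : measurable_fun Q f ->
  (exists M, forall x, Q x -> `|f x| <= M) -> mu.-integrable Q (EFin \o f).
Proof.
move=> mf [M fM]; apply: measurable_bounded_integrable mf _; first exact: mQ.
  exact: lebesgue_open_unit_cube_lty.
by exists M; split; [exact: num_real|move=> N MN x Qx; exact: le_trans (fM x Qx) (ltW MN)].
Qed.

Lemma cintegrable_expo v : cintegrable (expo v).
Proof.
split; apply: integrable_bounded_cube.
- apply: measurable_funTS; exact: measurable_Re_expo.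
- by exists 1 => x _; exact: cos_max.
- apply: measurable_funTS; exact: measurable_Im_expo.
- by exists 1 => x _; exact: sin_max.
Qed.

Lemma cintegral_expo v : cintegral mu Q (expo v) = (cube_sinc v)%:C%C.
Proof.
rewrite /cintegral /expo /Rintegral/=.
under eq_integral => x _ do rewrite -[2 * pi * _]add0r.
rewrite integral_cos_rV_dot cos0 mul1r/=.
have H : (\int[mu]_(x in Q) (sin (2 * pi * rV_dot v x))%:E = 0)%E.
  under eq_integral => x _ do rewrite -cosBpihalf addrC.
  by rewrite integral_cos_rV_dot cosN cos_pihalf mul0r.
by rewrite H.
Qed.

Lemma cintegrableD f g : cintegrable f -> cintegrable g ->
  cintegrable (fun x => f x + g x).
Proof.
move=> [f1 f2] [g1 g2]; split.
- apply: eq_integrable (integrableD mQ f1 g1) => // x _.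
  by rewrite /=; case: (f x); case: (g x).
- apply: eq_integrable (integrableD mQ f2 g2) => // x _.
  by rewrite /=; case: (f x); case: (g x).
Qed.

Let eqR (h k : 'rV[R]_n -> R) : {in Q, k =1 h} ->
  (\int[mu]_(x in Q) k x = \int[mu]_(x in Q) h x)%R.
Proof. by move=> kh; exact: eq_Rintegral. Qed.

Lemma cintegralD f g : cintegrable f -> cintegrable g ->
  cintegral mu Q (fun x => f x + g x) = cintegral mu Q f + cintegral mu Q g.
Proof.
move=> [f1 f2] [g1 g2]; rewrite /cintegral.
rewrite (@eqR (fun x => Re (f x) + Re (g x))); last first.
  by move=> x _; case: (f x); case: (g x).
rewrite [X in Complex _ X](@eqR (fun x => Im (f x) + Im (g x))); last first.
  by move=> x _; case: (f x); case: (g x).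
by rewrite !RintegralD.
Qed.

Let intZ (k : R) (g : 'rV[R]_n -> \bar R) : mu.-integrable Q g ->
  mu.-integrable Q (fun x => k%:E * g x)%E.
Proof. by move=> ig; exact: integrableZl. Qed.

Lemma cintegrableZ (c : R[i]) f : cintegrable f -> cintegrable (fun x => c * f x).
Proof.
move=> [f1 f2]; split.
- have := integrableB mQ (intZ (Re c) f1) (intZ (Im c) f2).
  by apply: eq_integrable => // x _; rewrite /=; case: c; case: (f x).
- have := integrableD mQ (intZ (Re c) f2) (intZ (Im c) f1).
  by apply: eq_integrable => // x _; rewrite /=; case: c; case: (f x).
Qed.

Lemma cintegralZ (c : R[i]) f : cintegrable f ->
  cintegral mu Q (fun x => c * f x) = c * cintegral mu Q f.
Proof.
move=> [f1 f2]; rewrite /cintegral.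
rewrite (@eqR (fun x => Re c * Re (f x) - Im c * Im (f x))); last first.
  by move=> x _; case: c; case: (f x).
rewrite [X in Complex _ X](@eqR (fun x => Re c * Im (f x) + Im c * Re (f x))); last first.
  by move=> x _; case: c; case: (f x).
rewrite RintegralB// ?RintegralD//; do ?[exact: (intZ _ f1)|exact: (intZ _ f2)].
by rewrite !RintegralZl//; case: c.
Qed.

Lemma cintegral_sum_expo I (r : seq I) (c : I -> R[i]) (v : I -> 'rV[R]_n) :
  cintegrable (fun x => \sum_(i <- r) c i * expo (v i) x) /\
  cintegral mu Q (fun x => \sum_(i <- r) c i * expo (v i) x) =
  \sum_(i <- r) c i * (cube_sinc (v i))%:C%C.
Proof.
elim: r => [|i r [IH1 IH2]].
  have i0 : mu.-integrable Q (fun=> 0%E) by exact: integrable0.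
  split; first by split; apply: eq_integrable i0 => // x _; rewrite big_nil.
  rewrite big_nil /cintegral; congr Complex.
    rewrite (@eqR (fun=> 0)) => [|x _]; last by rewrite big_nil.
    by rewrite Rintegral_cst// mul0r.
  rewrite (@eqR (fun=> 0)) => [|x _]; last by rewrite big_nil.
  by rewrite Rintegral_cst// mul0r.
have i1 := cintegrableZ (c i) (cintegrable_expo (v i)).
under [X in cintegrable X]funext => x do rewrite big_cons.
under [X in cintegral mu Q X]funext => x do rewrite big_cons.
split; first exact: cintegrableD.
by rewrite cintegralD// big_cons -IH2 cintegralZ ?cintegral_expo//; exact: cintegrable_expo.
Qed.

(* The square of the L^2 norm, which is easier to manipulate than [L2_norm]. *)
Definition energy f : \bar R := (\int[mu]_(x in Q) (normc (f x) ^+ 2)%:E)%E.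

(** The squared modulus expands into a double sum; flattened to a list of pairs, it is a single
    trigonometric polynomial with frequencies [v i - v j]. *)
Lemma energy_sum_expo I (r : seq I) (c : I -> R[i]) (v : I -> 'rV[R]_n) :
  energy (fun x => \sum_(i <- r) c i * expo (v i) x) =
  (Re (\sum_(i <- r) \sum_(j <- r)
     c i * conjc (c j) * (cube_sinc (v i - v j))%:C%C))%:E.
Proof.
pose s := [seq (i, j) | i <- r, j <- r].
have [h1 h2] := cintegral_sum_expo s (fun p => c p.1 * conjc (c p.2))
  (fun p => v p.1 - v p.2).
rewrite -(big_allpairs (F := fun p =>
  c p.1 * conjc (c p.2) * (cube_sinc (v p.1 - v p.2))%:C%C)) -/s.
rewrite -h2 /cintegral/= /Rintegral fineK; last exact: integrable_fin_num h1.1.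
apply: eq_integral => x _; congr _%:E; rewrite sqr_normc_Re_conj; congr Re.
rewrite big_allpairs/= rmorph_sum/= mulr_suml; apply: eq_bigr => i _.
rewrite mulr_sumr; apply: eq_bigr => j _.
by rewrite rmorphM expoD expoN; ring.
Qed.

Lemma L2_inner_expo u v : L2_inner mu Q (expo u) (expo v) = (cube_sinc (u - v))%:C%C.
Proof.
rewrite /L2_inner -cintegral_expo; congr cintegral; apply/funext => x.
by rewrite expoD expoN.
Qed.

End trigonometric_polynomials.

(** * Mean-square approximation by trigonometric polynomials *)

Section esum_seq.
Context {R : realType} {T : choiceType}.
Implicit Types (S : set T) (a : T -> \bar R) (s : seq T).
Local Open Scope ereal_scope.

(** This and the next two lemmas present [esum] as a supremum of finite sums, with duplicate-free
    sequences in place of finite sets. *)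
Lemma sum_seq_le_esum S a s : uniq s -> (forall i, i \in s -> S i) ->
  \sum_(i <- s) a i <= \esum_(i in S) a i.
Proof.
move=> us sS; apply: esum_ge; exists [set` s]; last by rewrite fsbig_seq.
by split; [exact: finite_seq|move=> i; exact: sS].
Qed.

Lemma esum_le_seq S a M :
  (forall s, uniq s -> (forall i, i \in s -> S i) -> \sum_(i <- s) a i <= M) ->
  \esum_(i in S) a i <= M.
Proof.
move=> H; apply: ge_ereal_sup => _ [X [finX XS] <-].
rewrite fsbig_finite//; apply: H => [|i]; first exact: finmap.fset_uniq.
by rewrite in_fset_set// inE; exact: XS.
Qed.

Lemma lt_esum_seq S a x : x < \esum_(i in S) a i ->
  exists s, [/\ uniq s, forall i, i \in s -> S i & x < \sum_(i <- s) a i].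
Proof.
move=> /ereal_sup_gt[_ [X [finX XS] <-] xa].
exists (finmap.enum_fset (fset_set X)); split; first exact: finmap.fset_uniq.
  by move=> i; rewrite in_fset_set// inE; exact: XS.
by rewrite -fsbig_finite.
Qed.

End esum_seq.

Section approximation.
Context {R : realType} {n : nat}.
Local Notation Q := (@open_unit_cube R n).
Local Notation mu := (lebesgue_rV n).
Local Notation Re := complex.Re.
Local Notation Im := complex.Im.
Local Notation normc := ComplexField.Normc.normc.
Implicit Types (u v : 'rV[R]_n) (f g h : 'rV[R]_n -> R[i]) (S : set 'rV[R]_n).

Let mQ : measurable Q := measurable_open_unit_cube.

Definition cmeasurable f :=
  measurable_fun Q (fun x => Re (f x)) /\ measurable_fun Q (fun x => Im (f x)).

Lemma energy_ge0 f : (0 <= energy f)%E.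
Proof. by apply: integral_ge0 => x _; rewrite lee_fin sqr_ge0. Qed.

Lemma L2_normE f : L2_norm mu Q f = ((energy f) `^ 2^-1)%E.
Proof. by []. Qed.

Lemma L2_norm_lt f (e : R) : 0 < e -> (L2_norm mu Q f < e%:E)%E = (energy f < (e ^+ 2)%:E)%E.
Proof.
move=> e0; rewrite L2_normE; have := energy_ge0 f.
case: (energy f) => [r r0| _|//].
  rewrite poweR_EFin !lte_fin powR12_sqrt// -{1}(ger0_norm (ltW e0)) -sqrtr_sqr.
  by rewrite ltr_sqrt// exprn_gt0.
by rewrite poweRyr.
Qed.

Lemma L2P f : L2 mu Q f <-> cmeasurable f /\ (energy f < +oo)%E.
Proof.
split=> [[? ? E]|[[? ?] E]]; split => //; move: E; rewrite L2_normE.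
  by apply: lty_poweRy.
exact: poweR_lty.
Qed.

Lemma cmeasurable_norm f : cmeasurable f ->
  measurable_fun Q (fun x => (normc (f x) ^+ 2)%:E).
Proof.
move=> [f1 f2]; apply/measurable_EFinP.
apply: (eq_measurable_fun (fun x => Re (f x) ^+ 2 + Im (f x) ^+ 2)).
  by move=> x _; rewrite sqr_normc_Re_Im.
by apply: measurable_funD; exact: measurable_funX.
Qed.

Lemma cmeasurableD f g : cmeasurable f -> cmeasurable g ->
  cmeasurable (fun x => f x + g x).
Proof.
move=> [f1 f2] [g1 g2]; split.
- apply: eq_measurable_fun (measurable_funD f1 g1) => x _ /=.
  by case: (f x); case: (g x).
- apply: eq_measurable_fun (measurable_funD f2 g2) => x _ /=.
  by case: (f x); case: (g x).
Qed.

Lemma cmeasurableM f g : cmeasurable f -> cmeasurable g ->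
  cmeasurable (fun x => f x * g x).
Proof.
move=> [f1 f2] [g1 g2]; split.
- have mB := measurable_funB (measurable_funM f1 g1) (measurable_funM f2 g2).
  apply: eq_measurable_fun mB => x _ /=.
  by case: (f x); case: (g x).
- have mD := measurable_funD (measurable_funM f1 g2) (measurable_funM f2 g1).
  apply: eq_measurable_fun mD => x _ /=.
  by case: (f x) => a b; case: (g x).
Qed.

Lemma cmeasurable_cst (c : R[i]) : cmeasurable (fun=> c).
Proof. by split; exact: measurable_cst. Qed.

Lemma cmeasurableB f g : cmeasurable f -> cmeasurable g ->
  cmeasurable (fun x => f x - g x).
Proof.
move=> mf mg; have := cmeasurableD mf (cmeasurableM (cmeasurable_cst (-1)) mg).
by under eq_fun do rewrite mulN1r.
Qed.

(** A pointwise substitute for Minkowski's inequality: [|z + w|^2 <= 2 |z|^2 + 2 |w|^2]. *)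
Lemma energyD_le f g : cmeasurable f -> cmeasurable g ->
  (energy (fun x => f x + g x)%R <= 2%:E * energy f + 2%:E * energy g)%E.
Proof.
move=> mf mg; have mfg := cmeasurableD mf mg.
have ? := cmeasurable_norm mf; have ? := cmeasurable_norm mg.
rewrite /energy -!ge0_integralZl//; do ?by move=> x _; rewrite lee_fin sqr_ge0.
rewrite -ge0_integralD//; do ?by move=> x _; rewrite -EFinM lee_fin mulr_ge0// sqr_ge0.
- apply: ge0_le_integral => //.
  + by move=> x _; rewrite lee_fin sqr_ge0.
  + exact: cmeasurable_norm.
  + by apply: emeasurable_funD; exact: measurable_funeM.
  + move=> x _; rewrite -!EFinM -EFinD lee_fin !sqr_normc_Re_Im.
    case: (f x) => a b; case: (g x) => c d /=.
    have := sqr_ge0 (a - c); have := sqr_ge0 (b - d); nra.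
- exact: measurable_funeM.
- exact: measurable_funeM.
Qed.

Lemma energyM_le f g (M : R) : 0 <= M -> cmeasurable f -> cmeasurable g ->
  (forall x, Q x -> normc (f x) ^+ 2 <= M) ->
  (energy (fun x => f x * g x)%R <= M%:E * energy g)%E.
Proof.
move=> M0 mf mg fM; have ? := cmeasurable_norm mg.
rewrite /energy -ge0_integralZl//; do ?by move=> x _; rewrite lee_fin sqr_ge0.
apply: ge0_le_integral => //.
- by move=> x _; rewrite lee_fin sqr_ge0.
- by apply: cmeasurable_norm; exact: cmeasurableM.
- exact: measurable_funeM.
- move=> x Qx; rewrite -!EFinM lee_fin ComplexField.Normc.normcM exprMn.
  by rewrite ler_wpM2r ?sqr_ge0// fM.
Qed.

End approximation.

(** * Mean-square closure of trigonometric polynomials, Bessel and Parseval *)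

Section parseval.
Context {R : realType} {n : nat}.
Local Notation Q := (@open_unit_cube R n).
Local Notation Re := complex.Re.
Local Notation Im := complex.Im.
Local Notation normc := ComplexField.Normc.normc.
Implicit Types (u v : 'rV[R]_n) (f g h : 'rV[R]_n -> R[i]) (S : set 'rV[R]_n).

(** Frequencies may be repeated in the list, which makes closure under sums and products immediate;
    [trigpoly_collect] merges the repetitions. *)
Definition trigpoly S f := exists p : seq (R[i] * 'rV[R]_n),
  (forall t, t \in p -> S t.2) /\
  forall x, f x = \sum_(t <- p) t.1 * expo t.2 x.

Lemma trigpolyD S f g : trigpoly S f -> trigpoly S g -> trigpoly S (fun x => f x + g x).
Proof.
move=> [p [pS fp]] [q [qS gq]]; exists (p ++ q); split.
  by move=> t; rewrite mem_cat => /orP[/pS|/qS].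
by move=> x; rewrite big_cat/= fp gq.
Qed.

Lemma trigpolyM S f g : (forall u v, S u -> S v -> S (u + v)) ->
  trigpoly S f -> trigpoly S g -> trigpoly S (fun x => f x * g x).
Proof.
move=> SD [p [pS fp]] [q [qS gq]].
exists [seq (t.1 * t'.1, t.2 + t'.2) | t <- p, t' <- q]; split.
  by move=> _ /allpairsP[[t t'] /= [/pS ? /qS ?] ->]; exact: SD.
move=> x; rewrite big_allpairs_dep/= fp gq mulr_suml; apply: eq_bigr => t _.
by rewrite mulr_sumr; apply: eq_bigr => t' _; rewrite expoD; ring.
Qed.

Lemma trigpolyZ_expo S (c : R[i]) v : S v -> trigpoly S (fun x => c * expo v x).
Proof.
move=> Sv; exists [:: (c, v)]; split; first by move=> t; rewrite inE => /eqP->.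
by move=> x; rewrite big_seq1.
Qed.

Lemma eq_trigpoly S f g : f =1 g -> trigpoly S f -> trigpoly S g.
Proof. by move=> fg [p [pS fp]]; exists p; split => // x; rewrite -fg. Qed.

Lemma trigpoly_cst S (c : R[i]) : S 0 -> trigpoly S (fun=> c).
Proof.
move=> S0; apply: eq_trigpoly (trigpolyZ_expo c S0) => x.
by rewrite expo0 mulr1.
Qed.

Lemma trigpolyZ S (c : R[i]) f : trigpoly S f -> trigpoly S (fun x => c * f x).
Proof.
move=> [p [pS fp]]; exists [seq (c * t.1, t.2) | t <- p]; split.
  by move=> _ /mapP[t /pS tS ->].
by move=> x; rewrite big_map fp mulr_sumr; apply: eq_bigr => t _; rewrite mulrA.
Qed.

Lemma trigpoly_collect S f : trigpoly S f -> exists (s : seq 'rV[R]_n) (c : 'rV[R]_n -> R[i]),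
  [/\ uniq s, forall i, i \in s -> S i & forall x, f x = \sum_(i <- s) c i * expo i x].
Proof.
move=> [p [pS fp]]; pose s := undup [seq t.2 | t <- p].
exists s, (fun i => \sum_(t <- p | t.2 == i) t.1); split.
- exact: undup_uniq.
- by move=> i; rewrite mem_undup => /mapP[t /pS tS ->].
- move=> x; rewrite fp.
  under [RHS]eq_bigr => i _ do rewrite mulr_suml.
  rewrite (exchange_big_dep xpredT)//= big_seq [RHS]big_seq; apply: eq_bigr => t tp.
  under eq_bigl => i do rewrite eq_sym.
  by rewrite -big_filter filter_pred1_uniq ?undup_uniq ?mem_undup ?map_f// big_seq1.
Qed.

Lemma cmeasurable_expo v : cmeasurable (expo v).
Proof.
split; apply: measurable_funTS; [exact: measurable_Re_expo|exact: measurable_Im_expo].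
Qed.

Lemma trigpoly_cmeasurable S f : trigpoly S f -> cmeasurable f.
Proof.
move=> [p [_ /funext->]]; elim: p => [|t p IH].
  by under eq_fun do rewrite big_nil; exact: cmeasurable_cst.
under eq_fun do rewrite big_cons.
apply: cmeasurableD => //; apply: cmeasurableM; first exact: cmeasurable_cst.
exact: cmeasurable_expo.
Qed.

(** Membership in the mean-square closure of the trigonometric polynomials over [S]. Measurability
    is bundled because the estimates on [energy] ask for it. *)
Definition approximable S f := cmeasurable f /\
  forall e : R, 0 < e ->
    exists2 g, trigpoly S g & (energy (fun x => f x - g x)%R < e%:E)%E.

Lemma approximable_lim S f : cmeasurable f ->
  (forall e : R, 0 < e ->
    exists2 g, approximable S g & (energy (fun x => f x - g x)%R < e%:E)%E) ->
  approximable S f.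
Proof.
(* [energyD_le] puts a factor 2 on each of the two errors, hence the quarter. *)
move=> mf H; split=> // e e0; have e4 : 0 < e / 4 by rewrite divr_gt0.
have [g [mg ag] fg] := H _ e4; have [h th gh] := ag _ e4.
exists h => //; have mh := trigpoly_cmeasurable th.
have -> : (fun x => f x - h x) = (fun x => (f x - g x) + (g x - h x)).
  by apply/funext => x; rewrite addrA subrK.
apply: le_lt_trans (energyD_le _ _) _; [exact: cmeasurableB..|].
have -> : e%:E = (2%:E * (e / 4)%:E + 2%:E * (e / 4)%:E)%E.
  by rewrite -!EFinM -EFinD; congr _%:E; lra.
by rewrite lteD// lte_pmul2l.
Qed.

Lemma approximable_trigpoly S f : trigpoly S f -> approximable S f.
Proof.
move=> tf; split; first exact: trigpoly_cmeasurable tf.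
move=> e e0; exists f => //; rewrite /energy integral0_eq// => x _.
by rewrite subrr ComplexField.Normc.normc0 expr0n.
Qed.

Lemma approximableD S f g : approximable S f -> approximable S g ->
  approximable S (fun x => f x + g x).
Proof.
move=> [mf af] [mg ag]; split; first exact: cmeasurableD.
move=> e e0; have e4 : 0 < e / 4 by rewrite divr_gt0.
have [f' tf ff'] := af _ e4; have [g' tg gg'] := ag _ e4.
exists (fun x => f' x + g' x); first exact: trigpolyD.
have -> : (fun x => f x + g x - (f' x + g' x)) = (fun x => (f x - f' x) + (g x - g' x)).
  by apply/funext => x; ring.
have mf' := trigpoly_cmeasurable tf; have mg' := trigpoly_cmeasurable tg.
apply: le_lt_trans (energyD_le _ _) _; [exact: cmeasurableB..|].
have -> : e%:E = (2%:E * (e / 4)%:E + 2%:E * (e / 4)%:E)%E.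
  by rewrite -!EFinM -EFinD; congr _%:E; lra.
by rewrite lteD// lte_pmul2l.
Qed.

(** Multiplication by a bounded function is continuous in mean square, so it is enough to control
    its products with trigonometric polynomials. *)
Lemma approximableMb S f g (M : R) : 0 <= M ->
  (forall x, Q x -> normc (f x) ^+ 2 <= M) -> cmeasurable f ->
  (forall h, trigpoly S h -> approximable S (fun x => f x * h x)) ->
  approximable S g -> approximable S (fun x => f x * g x).
Proof.
move=> M0 fM mf fh [mg ag]; apply: approximable_lim; first exact: cmeasurableM.
(* The bound [M] may be 0; [M + 1] is a safe divisor. *)
move=> e e0; have eM : 0 < e / (M + 1) by rewrite divr_gt0// ltr_wpDl.
have [h th gh] := ag _ eM; exists (fun x => f x * h x); first exact: fh.
under eq_fun do rewrite -mulrBr.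
have mh := trigpoly_cmeasurable th.
apply: le_lt_trans (@energyM_le _ _ _ _ (M + 1) _ _ _ _) _ => //.
- by rewrite addr_ge0.
- exact: cmeasurableB.
- by move=> x Qx; rewrite (le_trans (fM x Qx))// lerDl.
- have -> : e%:E = ((M + 1)%:E * (e / (M + 1))%:E)%E.
    by rewrite -EFinM mulrC divfK// gt_eqF// ltr_wpDl.
  by rewrite lte_pmul2l// lte_fin ltr_wpDl.
Qed.

Lemma normc_sum_le I (r : seq I) (F : I -> R[i]) :
  normc (\sum_(i <- r) F i) <= \sum_(i <- r) normc (F i).
Proof.
elim: r => [|i r IH]; first by rewrite !big_nil ComplexField.Normc.normc0.
by rewrite !big_cons (le_trans (le_normcD _ _))// lerD2l.
Qed.

Lemma trigpoly_bounded S f : trigpoly S f ->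
  exists2 M : R, 0 <= M & forall x, normc (f x) ^+ 2 <= M.
Proof.
move=> [p [_ fp]]; pose B : R := \sum_(t <- p) normc t.1.
have B0 : 0 <= B by apply: sumr_ge0 => t _; case: (t.1) => a b; exact: sqrtr_ge0.
exists (B ^+ 2) => [|x]; first exact: sqr_ge0.
have n0 : 0 <= normc (f x) by case: (f x) => a b; exact: sqrtr_ge0.
rewrite ler_sqr ?nnegrE// fp (le_trans (normc_sum_le _ _))//.
by apply: ler_sum => t _; rewrite ComplexField.Normc.normcM normc_expo mulr1.
Qed.

Lemma approximableM_trigpoly S f g : (forall u v, S u -> S v -> S (u + v)) ->
  trigpoly S f -> approximable S g -> approximable S (fun x => f x * g x).
Proof.
move=> SD tf; have [M M0 fM] := trigpoly_bounded tf.
apply: (approximableMb M0) => //; first exact: trigpoly_cmeasurable tf.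
by move=> h th; apply: approximable_trigpoly; exact: trigpolyM.
Qed.

(** [approximableMb] used a second time: the product of the bounded factor with a trigonometric
    polynomial is the case just proved, with the factors swapped. *)
Lemma approximableM S f g (M : R) : (forall u v, S u -> S v -> S (u + v)) ->
  0 <= M -> (forall x, Q x -> normc (f x) ^+ 2 <= M) ->
  approximable S f -> approximable S g -> approximable S (fun x => f x * g x).
Proof.
move=> SD M0 fM af ag; apply: (approximableMb M0) => //; first exact: af.1.
move=> h th; under eq_fun do rewrite mulrC; exact: approximableM_trigpoly.
Qed.

Lemma approximableZ S (c : R[i]) f : approximable S f -> approximable S (fun x => c * f x).
Proof.
apply: (@approximableMb S (fun=> c) f (normc c ^+ 2)).
- exact: sqr_ge0.
- by move=> x _; exact: lexx.
- exact: cmeasurable_cst.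
- by move=> h th; apply: approximable_trigpoly; exact: trigpolyZ.
Qed.

(** Transitivity of density: the closure is closed and contains the finite combinations of its
    elements. *)
Lemma approximable_trans S S' f : approximable S f ->
  (forall v, S v -> approximable S' (expo v)) -> approximable S' f.
Proof.
move=> [mf af] H; apply: approximable_lim => // e e0.
have [g [p [pS /funext gp]] fg] := af _ e0; exists g => //.
rewrite gp {gp fg}; elim: p pS => [|t p IH] pS.
  under eq_fun do rewrite big_nil; apply: approximable_trigpoly.
  by exists [::]; split => // x; rewrite big_nil.
under eq_fun do rewrite big_cons.
apply: approximableD; last by apply: IH => t' t'p; apply: pS; rewrite inE t'p orbT.
by apply: approximableZ; apply: H; apply: pS; rewrite mem_head.
Qed.

Definition orthogonal_freqs S :=
  forall u v, S u -> S v -> u != v -> cube_sinc (u - v) = 0.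

(* Completing the square: the best approximation takes [c i = cube_sinc (v - i)]. *)
Lemma energy_expoB_sum S (s : seq 'rV[R]_n) (c : 'rV[R]_n -> R[i]) v :
  orthogonal_freqs S -> uniq s -> (forall i, i \in s -> S i) ->
  energy (fun x => expo v x - \sum_(i <- s) c i * expo i x) =
  (1 - \sum_(i <- s) cube_sinc (v - i) ^+ 2
     + \sum_(i <- s) normc (c i - (cube_sinc (v - i))%:C%C) ^+ 2)%:E.
Proof.
move=> oS us sS.
(* The difference becomes one trigonometric polynomial: the index [None] carries [expo v], and
   options keep it apart from [s] even when [v] belongs to [s]. *)
pose C (o : option 'rV[R]_n) := if o is Some i then - c i else 1.
pose V (o : option 'rV[R]_n) := if o is Some i then i else v.
pose r := None :: map Some s.
transitivity (energy (fun x => \sum_(o <- r) C o * expo (V o) x)).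
  congr energy; apply/funext => x; rewrite big_cons big_map/= mul1r -sumrN.
  by congr (_ + _); apply: eq_bigr => i _; rewrite mulNr.
rewrite energy_sum_expo; congr _%:E.
rewrite big_cons big_map/= big_cons big_map/= mul1r subrr cube_sinc0.
(* By orthogonality, row [i] retains only its cross term with [v] and its diagonal term. *)
have -> : \sum_(i <- s) \sum_(o <- r) - c i * (C o)^*%C * (cube_sinc (i - V o))%:C%C =
    \sum_(i <- s) (- c i * (cube_sinc (i - v))%:C%C + c i * (c i)^*%C).
  rewrite big_seq [RHS]big_seq; apply: eq_bigr => i si.
  rewrite big_cons big_map; congr (_ + _); first by rewrite /C /V rmorph1 mulr1.
  rewrite (bigD1_seq i)//= subrr cube_sinc0 rmorphN mulrNN mulr1.
  rewrite big_seq_cond big1 ?addr0// => j /andP[sj ji].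
  by rewrite oS ?mulr0//; [exact: sS|exact: sS|rewrite eq_sym].
rewrite -addrA -big_split/= -addrA -[X in _ = _ + X]addrC -sumrN -big_split/=.
have ReD (z w : R[i]) : Re (z + w) = Re z + Re w by case: z; case: w.
rewrite ReD Re_sum/=; congr (_ + _); first by simpl; ring.
apply: eq_bigr => i _; rewrite -(cube_sincN (i - v)) opprB.
rewrite sqr_normc_Re_Im.
by case: (c i) => a b /=; ring.
Qed.

(** With the optimal coefficients the energy of the remainder is [1] minus this sum, and an energy
    is nonnegative. *)
Lemma bessel S s v : orthogonal_freqs S -> uniq s -> (forall i, i \in s -> S i) ->
  \sum_(i <- s) cube_sinc (v - i) ^+ 2 <= 1.
Proof.
move=> oS us sS.
have := energy_ge0 (fun x => expo v x - \sum_(i <- s) (cube_sinc (v - i))%:C%C * expo i x).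
rewrite (energy_expoB_sum _ _ oS us sS) [X in _ + X]big1 ?addr0 ?lee_fin ?subr_ge0//.
by move=> i _; rewrite subrr ComplexField.Normc.normc0 expr0n.
Qed.

(** By [energy_expoB_sum], an approximation of error less than [e] forces a partial sum above
    [1 - e]; conversely a partial sum above [1 - e], with its optimal coefficients, gives an error
    less than [e]. *)
Lemma parsevalP S v : orthogonal_freqs S ->
  approximable S (expo v) <->
  (\esum_(i in S) (cube_sinc (v - i) ^+ 2)%:E = 1)%E.
Proof.
move=> oS.
have le1 : (\esum_(i in S) (cube_sinc (v - i) ^+ 2)%:E <= 1)%E.
  by apply: esum_le_seq => s us sS; rewrite sumEFin lee_fin; exact: bessel oS us sS.
split=> [[mv H]|E1].
  apply/eqP; rewrite eq_le le1/=; apply/lee_addgt0Pr => e e0.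
  have [g tg] := H e e0; have [s [c [us sS /funext->]]] := trigpoly_collect tg.
  rewrite (energy_expoB_sum _ _ oS us sS) lte_fin => ge.
  apply: le_trans (leeD2r _ (sum_seq_le_esum _ us sS)).
  rewrite sumEFin -EFinD lee_fin.
  have : 0 <= \sum_(i <- s) normc (c i - (cube_sinc (v - i))%:C%C) ^+ 2.
    by apply: sumr_ge0 => i _; exact: sqr_ge0.
  by move: ge; set A := \sum_(i <- s) _; set B := \sum_(i <- s) _; lra.
split; first exact: cmeasurable_expo.
move=> e e0.
have : ((1 - e)%:E < \esum_(i in S) (cube_sinc (v - i) ^+ 2)%:E)%E.
  by rewrite E1 lte_fin ltrBlDr ltrDl.
move=> /lt_esum_seq[s [us sS]]; rewrite sumEFin lte_fin => es.
exists (fun x => \sum_(i <- s) (cube_sinc (v - i))%:C%C * expo i x).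
  exists [seq ((cube_sinc (v - i))%:C%C, i) | i <- s]; split.
    by move=> _ /mapP[i si ->]; exact: sS.
  by move=> x; rewrite big_map.
rewrite (energy_expoB_sum _ _ oS us sS) lte_fin [X in _ + X]big1 ?addr0.
  by rewrite ltrBlDr -ltrBlDl.
by move=> i _; rewrite subrr ComplexField.Normc.normc0 expr0n.
Qed.

End parseval.

(** * Density of the integer frequencies *)

Section density_tools.
Context {R : realType} {n : nat}.
Local Notation Q := (@open_unit_cube R n).
Local Notation mu := (lebesgue_rV n).
Local Notation Re := complex.Re.
Local Notation Im := complex.Im.
Local Notation normc := ComplexField.Normc.normc.
Implicit Types (u v : 'rV[R]_n) (f g h : 'rV[R]_n -> R[i]) (S : set 'rV[R]_n)
  (F G : 'rV[R]_n -> R).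

Let mQ : measurable Q := measurable_open_unit_cube.

Definition approximableR S F := approximable S (fun x => (F x)%:C%C).

Lemma cmeasurable_real F : measurable_fun Q F -> cmeasurable (fun x => (F x)%:C%C).
Proof. by move=> mF; split. Qed.

Lemma eq_approximable S f g : (forall x, Q x -> f x = g x) ->
  approximable S f -> approximable S g.
Proof.
move=> fg [[f1 f2] af]; split.
  by split; [apply: eq_measurable_fun f1|apply: eq_measurable_fun f2];
    move=> x /[!inE] Qx; rewrite fg.
move=> e e0; have [h th fh] := af e e0; exists h => //.
move: fh; congr (_ < _)%E; apply: eq_integral => x /[!inE] Qx.
by rewrite fg.
Qed.

(** Dominated convergence for the squared errors. *)
Lemma approximableR_lim S F (F_ : nat -> 'rV[R]_n -> R) G :
  measurable_fun Q F -> (forall k, approximableR S (F_ k)) ->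
  {ae mu, forall x, Q x -> F_ ^~ x @ \oo --> F x} ->
  mu.-integrable Q (EFin \o G) ->
  (forall x k, Q x -> (F x - F_ k x) ^+ 2 <= G x) ->
  approximableR S F.
Proof.
move=> mF aF FF iG FG; apply: approximable_lim; first exact: cmeasurable_real.
move=> e e0.
have mF_ k : measurable_fun Q (F_ k) by case: (aF k) => -[].
pose E k := energy (fun x => (F x)%:C%C - (F_ k x)%:C%C).
have EE k : E k = (\int[mu]_(x in Q) ((F x - F_ k x) ^+ 2)%:E)%E.
  apply: eq_integral => x _; congr _%:E.
  by rewrite sqr_normc_Re_Im/= subr0 expr0n addr0.
have := @dominated_convergence _ _ _ mu Q mQ (fun k x => ((F x - F_ k x) ^+ 2)%:E)
  (fun=> 0%E) (EFin \o G).
case.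
- by move=> k; apply/measurable_EFinP/measurable_funX/measurable_funB.
- exact: measurable_cst.
- apply: filterS FF => x H Qx; rewrite -[0%E]/(EFin 0).
  apply: cvg_EFin; first exact: nearW.
  have C : (fun k => F x - F_ k x) @ \oo --> F x - F x.
    by apply: cvgB; [exact: cvg_cst|exact: H].
  rewrite [X in X @ _](_ : _ = (fun k => (F x - F_ k x) * (F x - F_ k x))).
    by have := cvgM C C; rewrite subrr mulr0; apply.
  by apply/funext => k; rewrite /= expr2.
- exact: iG.
- apply: aeW => x k Qx; rewrite /= lee_fin ger0_norm ?sqr_ge0//; exact: FG.
move=> _ _; rewrite integral0 => E0.
have [N _ H] := E0 _ (@nbhs_open_ereal_lt _ 0 (fun=> e) e0).
exists (fun x => (F_ N x)%:C%C); first exact: aF.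
by move: (H N (leqnn N)); rewrite /= -EE.
Qed.

Lemma integrable_cst_cube (c : R) : mu.-integrable Q (EFin \o cst c).
Proof.
apply: integrable_bounded_cube; first exact: measurable_cst.
by exists `|c| => x _.
Qed.

Lemma approximableRD S F G : approximableR S F -> approximableR S G ->
  approximableR S (fun x => F x + G x).
Proof.
move=> aF aG; have := approximableD aF aG; apply: eq_approximable => x _.
by rewrite rmorphD.
Qed.

Lemma approximableRZ S (c : R) F : approximableR S F -> approximableR S (fun x => c * F x).
Proof.
move=> aF; have := approximableZ c%:C%C aF; apply: eq_approximable => x _.
by rewrite rmorphM.
Qed.

Lemma approximableRM S F G (M : R) : (forall u v, S u -> S v -> S (u + v)) ->
  0 <= M -> (forall x, Q x -> F x ^+ 2 <= M) ->
  approximableR S F -> approximableR S G -> approximableR S (fun x => F x * G x).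
Proof.
move=> SD M0 FM aF aG.
have := @approximableM _ _ S (fun x => (F x)%:C%C) (fun x => (G x)%:C%C) M SD M0 _ aF aG.
move=> H; apply: eq_approximable (H _) => [x _|x Qx]; first by rewrite rmorphM.
by rewrite sqr_normc_Re_Im/= expr0n addr0 FM.
Qed.

Lemma approximableR_cst S (c : R) : S 0 -> approximableR S (fun=> c).
Proof. by move=> S0; apply: approximable_trigpoly; exact: trigpoly_cst. Qed.

Section indicators.
Variable S : set 'rV[R]_n.
Hypotheses (S0 : S 0) (SD : forall u v, S u -> S v -> S (u + v)).

Definition indic_approximable (A : set 'rV[R]_n) :=
  measurable A /\ approximableR S (\1_A : 'rV[R]_n -> R).

Lemma indic_approximable0 : indic_approximable set0.
Proof.
split=> //; apply: eq_approximable (approximableR_cst 0 S0) => x _.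
by rewrite indic0.
Qed.

Lemma indic_approximableC A : indic_approximable A -> indic_approximable (~` A).
Proof.
move=> [mA aA]; split; first exact: measurableC.
have := approximableRD (approximableR_cst 1 S0) (approximableRZ (-1) aA).
apply: eq_approximable => x _; congr (_%:C)%C.
by rewrite !indicE in_setC; case: (_ \in _) => /=; ring.
Qed.

Lemma indic_approximableI A B :
  indic_approximable A -> indic_approximable B -> indic_approximable (A `&` B).
Proof.
move=> [mA aA] [mB aB]; split; first exact: measurableI.
have : approximableR S (fun x => \1_A x * \1_B x).
  apply: (approximableRM SD ler01 _ aA aB) => x _.
  by rewrite indicE; case: (_ \in _); rewrite ?expr0n ?expr1n.
apply: eq_approximable => x _; congr (_%:C)%C.
by rewrite !indicE in_setI; case: (_ \in _); case: (_ \in _); rewrite ?mulr1 ?mulr0.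
Qed.

(** Finite unions follow from complements and intersections. Their indicators are eventually
    constant at each point, and the constant 1 dominates the squared errors. *)
Lemma indic_approximable_bigcup (A : nat -> set 'rV[R]_n) :
  (forall k, indic_approximable (A k)) -> indic_approximable (\bigcup_k A k).
Proof.
move=> aA; have mU : measurable (\bigcup_k A k).
  by apply: bigcupT_measurable => k; case: (aA k).
split=> //.
pose U k := \big[setU/set0]_(i < k) A i.
have aU k : indic_approximable (U k).
  rewrite /U; elim: k => [|k IH]; first by rewrite big_ord0; exact: indic_approximable0.
  rewrite big_ord_recr/= -[X in indic_approximable X]setCK setCU.
  by apply: indic_approximableC; apply: indic_approximableI; exact: indic_approximableC.
apply: (@approximableR_lim _ _ (fun k => \1_(U k)) (fun=> 1)).
- by apply: measurable_funTS; exact: measurable_indic.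
- by move=> k; case: (aU k).
- apply: aeW => x _; apply: cvg_near_cst.
  have [[k _ Akx]|nx] := pselect ((\bigcup_k A k) x).
    near=> m; have Um : U m x.
      rewrite /U -bigcup_mkord; exists k => //=.
      by near: m; exact: nbhs_infty_gt.
    by rewrite !indicE !mem_set//; exists k.
  apply: nearW => m; have Um : ~ U m x.
    by rewrite /U -bigcup_mkord => -[k _ Akx]; apply: nx; exists k.
  by rewrite !indicE !memNset.
- exact: integrable_cst_cube.
- move=> x k _; rewrite !indicE; case: (_ \in _); case: (_ \in _) => /=;
    rewrite ?subrr ?expr0n ?subr0 ?expr1n ?sub0r ?sqrrN ?expr1n//=.
Unshelve. all: by end_near. Qed.

(* The sets with approximable indicator form a sigma-algebra, so that it is enough to
   approximate the indicators of the half-spaces generating the Borel sets. *)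
Lemma indic_approximable_measurable :
  (forall (i : 'I_n) (c : R), indic_approximable (rV_coord i @^-1` `]c, +oo[%classic)) ->
  forall A, measurable A -> indic_approximable A.
Proof.
move=> H; apply: smallest_sub.
  split => /=.
  - exact: indic_approximable0.
  - by move=> A aA; rewrite setTD; exact: indic_approximableC.
  - exact: indic_approximable_bigcup.
rewrite -bigcup_seq; apply: bigcup_sub => i _ A [B mB <-]; rewrite setTI.
have {}mB : (@RGenOInfty.G R).-sigma.-measurable B by rewrite -RGenOInfty.measurableE.
move: B mB; suff : @measurable _ (g_sigma_algebraType (@RGenOInfty.G R)) `<=`
  [set B | indic_approximable (rV_coord i @^-1` B)] by [].
apply: smallest_sub.
  split => /=.
  - by rewrite preimage_set0; exact: indic_approximable0.
  - by move=> B aB; rewrite setTD preimage_setC; exact: indic_approximableC.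
  - by move=> B aB; rewrite preimage_bigcup; exact: indic_approximable_bigcup.
by move=> _ [c ->]; exact: H.
Qed.

End indicators.
End density_tools.

(** * Approximating a step by polynomials in a trigonometric wave *)

Section step_limits.
Context {R : realType}.

Lemma bernoulli_ineq (y : R) m : 0 <= y <= 1 -> 1 - y *+ m <= (1 - y) ^+ m.
Proof.
move=> /andP[y0 y1]; elim: m => [|m IH]; first by rewrite mulr0n subr0 expr0.
rewrite exprSr (le_trans _ (ler_wpM2r _ IH)) ?subr_ge0//.
rewrite mulrS; have : 0 <= y *+ m by rewrite mulrn_wge0.
by move: (y *+ m) => z z0; nra.
Qed.

(** The bound [(1 - y)^m <= 1 / (1 + m y)] without its quotient; the induction rests on
    [(1 - y) (1 + (m + 1) y) <= 1 + m y]. *)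
Lemma bernoulli_ineq_inv (y : R) m : 0 <= y <= 1 -> (1 - y) ^+ m * (1 + y *+ m) <= 1.
Proof.
move=> /andP[y0 y1]; elim: m => [|m IH]; first by rewrite mulr0n expr0 addr0 mulr1.
apply: le_trans IH; rewrite exprSr -mulrA ler_wpM2l ?exprn_ge0 ?subr_ge0//.
rewrite mulrS; have : 0 <= y *+ m by rewrite mulrn_wge0.
by move: (y *+ m) => z z0; nra.
Qed.

(* Tends to the indicator of [s < 1/2], as in the Brosowski-Deutsch proof of the
   Stone-Weierstrass theorem. *)
Definition sharpen (s : R) k := (1 - s ^+ k) ^+ (2 ^ k)%N.

Lemma sharpen_itv s k : 0 <= s <= 1 -> 0 <= sharpen s k <= 1.
Proof.
move=> /andP[s0 s1]; have h : 0 <= 1 - s ^+ k <= 1.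
  by rewrite subr_ge0 exprn_ile1//= lerBlDr lerDl exprn_ge0.
case/andP: h => h0 h1.
by rewrite exprn_ge0//= exprn_ile1.
Qed.

(** Bernoulli's inequality bounds [sharpen s k] below by [1 - (2 s)^k]. *)
Lemma cvg_sharpen_lt s : 0 <= s < 2^-1 -> sharpen s @ \oo --> (1 : R).
Proof.
move=> /andP[s0 s2]; have s1 : s <= 1 by lra.
have q1 : `|2 * s| < 1 by rewrite ger0_norm; lra.
have C : (fun k => 1 - (2 * s) ^+ k) @ \oo --> (1 : R).
  rewrite -[X in _ --> X]subr0; apply: cvgB; first exact: cvg_cst.
  exact: cvg_expr.
apply: (squeeze_cvgr _ C (cvg_cst (1 : R))).
apply: nearW => k; rewrite andbC (andP (sharpen_itv k _)).2 ?s0//=.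
rewrite (le_trans _ (bernoulli_ineq _ _)) ?exprn_ge0 ?exprn_ile1//.
by rewrite -[X in _ <= 1 - X]mulr_natl natrX -exprMn.
Qed.

(** The companion inequality bounds [sharpen s k] above by [(2 s)^(-k)]. *)
Lemma cvg_sharpen_gt s : 2^-1 < s <= 1 -> sharpen s @ \oo --> (0 : R).
Proof.
move=> /andP[s2 s1]; have s0 : 0 <= s by lra.
have q1 : `|(2 * s)^-1| < 1.
  rewrite ger0_norm ?invr_ge0; last lra.
  by rewrite invf_lt1; lra.
apply: (squeeze_cvgr _ (cvg_cst (0 : R)) (cvg_expr q1)).
apply: nearW => k; rewrite (andP (sharpen_itv k _)).1 ?s0//=.
have := @bernoulli_ineq_inv (s ^+ k) (2 ^ k)%N.
rewrite exprn_ge0// exprn_ile1// => /(_ isT).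
rewrite -[s ^+ k *+ _]mulr_natl natrX -exprMn -/(sharpen s k) => H.
have p : 0 < (2 * s) ^+ k by rewrite exprn_gt0//; lra.
rewrite exprVn -[leRHS]mul1r ler_pdivlMr//; apply: le_trans H.
rewrite ler_wpM2l//; first by case/andP: (sharpen_itv k (introT andP (conj s0 s1))).
by rewrite lerDr.
Qed.

(* On (-1/2, 1/2) this wave is below [1/2] to the right of [c] and above [1/2] to its left,
   and by the product-to-sum formula it only involves the frequencies -1, 0 and 1. *)
Definition ray_wave (c t : R) : R := 2^-1 - sin (pi * (t - c)) * cos (pi * t) / 2.

Lemma ray_waveE c t : ray_wave c t =
  2^-1 + sin (pi * c) / 4
    + (sin (pi * c) * cos (2 * pi * t) - cos (pi * c) * sin (2 * pi * t)) / 4.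
Proof.
rewrite /ray_wave -[2 * pi * t]mulrA [2 * _]mulr_natl cos_mulr2n sin_mulr2n mulrBr sinB.
set a := sin (pi * t); set b := cos (pi * t).
by move: (sin (pi * c)) (cos (pi * c)) => p q; rewrite !mulr2n; field.
Qed.

Lemma ray_wave_itv c t : 0 <= ray_wave c t <= 1.
Proof.
have : `|sin (pi * (t - c)) * cos (pi * t)| <= 1.
  by rewrite normrM mulr_ile1// ?sin_max ?cos_max.
by rewrite /ray_wave; move: (sin _ * _) => y; rewrite ler_norml; lra.
Qed.

Lemma cos_pi_gt0 (t : R) : `|t| < 2^-1 -> 0 < cos (pi * t).
Proof.
rewrite ltr_norml => /andP[t1 t2]; apply: cos_gt0_pihalf.
have := pi_gt0 R; move: pi => p p0; nra.
Qed.

Lemma sin_pi_gt0 (t : R) : 0 < t < 1 -> 0 < sin (pi * t).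
Proof.
move=> /andP[t1 t2]; apply: sin_gt0_pi.
have := pi_gt0 R; move: pi => p p0; nra.
Qed.

Lemma ray_wave_lt c t : `|c| < 2^-1 -> `|t| < 2^-1 -> c < t -> ray_wave c t < 2^-1.
Proof.
move=> c2 t2 ct; rewrite /ray_wave ltrBlDr ltrDl divr_gt0// mulr_gt0//.
  by apply: sin_pi_gt0; move: c2 t2; rewrite !ltr_norml; lra.
exact: cos_pi_gt0.
Qed.

Lemma ray_wave_gt c t : `|c| < 2^-1 -> `|t| < 2^-1 -> t < c -> 2^-1 < ray_wave c t.
Proof.
move=> c2 t2 ct; rewrite /ray_wave ltrDl oppr_gt0 pmulr_llt0 ?invr_gt0//.
rewrite pmulr_llt0; last exact: cos_pi_gt0.
rewrite -opprB mulrN sinN oppr_lt0.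
by apply: sin_pi_gt0; move: c2 t2; rewrite !ltr_norml; lra.
Qed.

End step_limits.

(** * Density of integer-frequency trigonometric polynomials in L^2(Q) *)

Section density.
Context {R : realType} {n : nat}.
Local Notation Q := (@open_unit_cube R n).
Local Notation mu := (lebesgue_rV n).
Local Notation Re := complex.Re.
Local Notation Im := complex.Im.
Local Notation normc := ComplexField.Normc.normc.
Implicit Types (u v : 'rV[R]_n) (f g h : 'rV[R]_n -> R[i]) (S : set 'rV[R]_n)
  (F G : 'rV[R]_n -> R).

Let mQ : measurable Q := measurable_open_unit_cube.

Definition int_freqs : set 'rV[R]_n := [set v | forall i, v ord0 i \is a Num.int].

Lemma int_freqs0 : int_freqs 0.
Proof. by move=> i; rewrite mxE rpred0. Qed.

Lemma int_freqsD u v : int_freqs u -> int_freqs v -> int_freqs (u + v).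
Proof. by move=> iu iv i; rewrite mxE rpredD. Qed.

Lemma int_freqsN u : int_freqs u -> int_freqs (- u).
Proof. by move=> iu i; rewrite mxE rpredN. Qed.

Lemma rV_dot_delta (i : 'I_n) (x : 'rV[R]_n) : rV_dot (delta_mx ord0 i) x = x ord0 i.
Proof.
rewrite /rV_dot (bigD1 i)//= mxE !eqxx mul1r big1 ?addr0// => j ji.
by rewrite mxE (negPf ji) mul0r.
Qed.

Lemma int_freqs_delta i : int_freqs (delta_mx ord0 i).
Proof. by move=> j; rewrite mxE eqxx/=; case: (j == i). Qed.

Lemma trigpoly_ray_wave (i : 'I_n) (c : R) :
  trigpoly int_freqs (fun x => (ray_wave c (x ord0 i))%:C%C).
Proof.
(* The terms in [w] and its conjugate add up to twice a real part, which is the oscillating part of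
   [ray_waveE]; hence 8 in place of 4. *)
pose w := Complex (sin (pi * c) / 8) (cos (pi * c) / 8).
have t1 : trigpoly int_freqs (fun=> (2^-1 + sin (pi * c) / 4)%:C%C).
  exact: trigpoly_cst int_freqs0.
have t2 := trigpolyZ_expo w (int_freqs_delta i).
have t3 := trigpolyZ_expo (conjc w) (int_freqsN (int_freqs_delta i)).
apply: eq_trigpoly (trigpolyD t1 (trigpolyD t2 t3)) => x.
rewrite expoN ray_waveE /expo rV_dot_delta /w.
apply/eqP; rewrite eq_complex/=; apply/andP; split; apply/eqP.
  by field.
by field.
Qed.

Lemma trigpolyX S f k : S 0 -> (forall u v, S u -> S v -> S (u + v)) ->
  trigpoly S f -> trigpoly S (fun x => f x ^+ k).
Proof.
move=> S0 SD tf; elim: k => [|k IH]; first exact: trigpoly_cst.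
by under eq_fun do rewrite exprS; exact: trigpolyM.
Qed.

Lemma trigpoly_sharpen F k : trigpoly int_freqs (fun x => (F x)%:C%C) ->
  trigpoly int_freqs (fun x => (sharpen (F x) k)%:C%C).
Proof.
move=> tF; have tX := trigpolyX k int_freqs0 int_freqsD tF.
have t1 := trigpolyD (trigpoly_cst 1 int_freqs0) (trigpolyZ (-1) tX).
apply: eq_trigpoly (trigpolyX (2 ^ k)%N int_freqs0 int_freqsD t1) => x.
by rewrite /sharpen rmorphXn rmorphB rmorph1 rmorphXn mulN1r.
Qed.

(** A box with a single point as side [i]: the factor 0 absorbs the infinite lengths of the other
    sides. *)
Lemma hyperplane_null (i : 'I_n) (c : R) : mu [set x : 'rV[R]_n | x ord0 i = c] = 0%E.
Proof.
pose A j : set R := if j == i then [set c] else setT.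
have -> : [set x : 'rV[R]_n | x ord0 i = c] = [set x : 'rV[R]_n | forall j, A j (x ord0 j)].
  apply/seteqP; split => x /=.
    by move=> xi j; rewrite /A; case: eqP => // ->.
  by move=> /(_ i); rewrite /A eqxx.
rewrite lebesgue_rV_box; last by move=> j; rewrite /A; case: ifP.
rewrite (bigD1 i)//= {1}/A eqxx lebesgue_measure_set1 mul0e//.
Qed.

Lemma measurable_hyperplane (i : 'I_n) (c : R) : measurable [set x : 'rV[R]_n | x ord0 i = c].
Proof.
rewrite (_ : mkset _ = rV_coord i @^-1` [set c])//.
by rewrite -[X in measurable X]setTI; exact: measurable_rV_coord.
Qed.

(** If the bounding hyperplane misses the cube, the indicator is constant on it. Otherwise
    sharpening the wave through [c] gives trigonometric polynomials that tend to the indicator. *)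
Lemma indic_approximable_ray (i : 'I_n) (c : R) :
  indic_approximable int_freqs (rV_coord i @^-1` `]c, +oo[%classic).
Proof.
have mA : measurable (rV_coord i @^-1` `]c, +oo[%classic : set 'rV[R]_n).
  by rewrite -[X in measurable X]setTI; exact: measurable_rV_coord.
split => //.
have Qi x : Q x -> `|x ord0 i| < 2^-1 by move=> /(_ i); rewrite ltr_norml.
have [c1|c1] := leP c (- 2^-1).
  apply: eq_approximable (approximableR_cst 1 int_freqs0) => x /Qi.
  rewrite ltr_norml => /andP[x1 _]; rewrite indicE mem_set//=.
  by rewrite in_itv/= andbT; exact: le_lt_trans x1.
have [c2|c2] := leP 2^-1 c.
  apply: eq_approximable (approximableR_cst 0 int_freqs0) => x /Qi.
  rewrite ltr_norml => /andP[_ x1]; rewrite indicE memNset//=.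
  by rewrite in_itv/= andbT; apply/negP; rewrite -leNgt (le_trans (ltW x1)).
have c3 : `|c| < 2^-1 by rewrite ltr_norml c1.
apply: (@approximableR_lim _ _ _ _ (fun k x => sharpen (ray_wave c (x ord0 i)) k) (fun=> 1)).
- by apply: measurable_funTS; exact: measurable_indic.
- move=> k; apply: approximable_trigpoly.
  exact: trigpoly_sharpen (trigpoly_ray_wave i c).
(* On this hyperplane the wave equals 1/2, where [sharpen] tends to 1/e; it is the exceptional null
   set. *)
- exists [set x : 'rV[R]_n | x ord0 i = c]; split.
  + exact: measurable_hyperplane.
  + exact: hyperplane_null.
  + move=> x /=; apply: contra_notP => xc /Qi x2.
    have [r0 r1] := andP (ray_wave_itv c (x ord0 i)).
    case: (ltgtP (x ord0 i) c) => // cx.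
      rewrite indicE memNset; last first.
        by rewrite /= in_itv/= andbT /rV_coord; apply/negP; rewrite -leNgt ltW.
      by apply: cvg_sharpen_gt; rewrite r1 andbT ray_wave_gt.
    rewrite indicE mem_set; last by rewrite /= in_itv/= andbT.
    by apply: cvg_sharpen_lt; rewrite r0 ray_wave_lt.
- exact: integrable_cst_cube.
- move=> x k _; have /andP[s0 s1] := sharpen_itv k (ray_wave_itv c (x ord0 i)).
  by rewrite indicE; case: (_ \in _) => /=; nra.
Qed.

Lemma indic_approximable_int A : measurable A -> indic_approximable int_freqs A.
Proof.
move: A; apply: indic_approximable_measurable.
- exact: int_freqs0.
- exact: int_freqsD.
- exact: indic_approximable_ray.
Qed.

Import HBNNSimple.

Lemma approximableR_nnsfun (F : {nnsfun 'rV[R]_n >-> R}) : approximableR int_freqs F.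
Proof.
have -> : (F : 'rV[R]_n -> R) = fun x =>
    \sum_(y <- finmap.enum_fset (fset_set (range F))) (y * \1_(F @^-1` [set y]) x).
  by apply/funext => x; rewrite fimfunE fsbig_finite.
elim: (finmap.enum_fset _) => [|y r IH].
  under eq_fun do rewrite big_nil; exact: approximableR_cst int_freqs0.
under eq_fun do rewrite big_cons.
apply: approximableRD IH; apply: approximableRZ.
by case: (@indic_approximable_int (F @^-1` [set y])).
Qed.

(** Simple functions with [0 <= F_ k <= F] converge to [F], so [F ^+ 2] dominates the squared
    errors. *)
Lemma approximableR_ge0 F : measurable_fun Q F -> (forall x, Q x -> 0 <= F x) ->
  mu.-integrable Q (EFin \o (fun x => F x ^+ 2)) -> approximableR int_freqs F.
Proof.
move=> mF F0 iF.
have mEF : measurable_fun Q (EFin \o F) by exact/measurable_EFinP.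
have F0E x : Q x -> (0 <= (EFin \o F) x)%E by move=> /F0; rewrite lee_fin.
pose F_ := nnsfun_approx mQ mEF.
apply: (@approximableR_lim _ _ _ _ (fun k => F_ k) (fun x => F x ^+ 2)) => //.
- by move=> k; exact: approximableR_nnsfun.
- apply: aeW => x Qx; have := cvg_nnsfun_approx mQ mEF F0E Qx.
  by move/fine_cvgP => [_].
- move=> x k Qx.
  have : F_ k x <= F x by rewrite -lee_fin /F_ nnsfun_approxE; exact: le_approx.
  have : 0 <= F_ k x by exact: fun_ge0.
  by move: (F_ k x) (F0 x Qx) => a; nra.
Qed.

Lemma approximableR_int F : measurable_fun Q F ->
  mu.-integrable Q (EFin \o (fun x => F x ^+ 2)) -> approximableR int_freqs F.
Proof.
move=> mF iF.
have H G : measurable_fun Q G -> (forall x, 0 <= G x) -> (forall x, G x ^+ 2 <= F x ^+ 2) ->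
    approximableR int_freqs G.
  move=> mG G0 GF; apply: approximableR_ge0 => //.
  apply: le_integrable iF => //; first exact/measurable_EFinP/measurable_funX.
  by move=> x _; rewrite /= lee_fin !ger0_norm ?sqr_ge0.
have a1 : approximableR int_freqs (fun x => Num.max (F x) 0).
  apply: H; first exact: measurable_maxr.
  - by move=> x; rewrite le_max lexx orbT.
  - by move=> x; case: (leP (F x) 0) => // _; rewrite expr0n sqr_ge0.
have a2 : approximableR int_freqs (fun x => Num.max (- F x) 0).
  apply: H; first by apply: measurable_maxr => //; exact: measurable_funN.
  - by move=> x; rewrite le_max lexx orbT.
  - by move=> x; case: (leP (- F x) 0) => // _; rewrite ?sqrrN// expr0n sqr_ge0.
have := approximableRD a1 (approximableRZ (-1) a2).
apply: eq_approximable => x _; congr (_%:C)%C.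
by case: (leP (F x) 0) => h1; case: (leP (- F x) 0) => h2; lra.
Qed.

(** The last stage of the density argument: real and imaginary parts, after the positive and
    negative parts of a real function. *)
Lemma L2_approximable f : L2 mu Q f -> approximable int_freqs f.
Proof.
move=> /L2P[[mr mi] fE].
have iE : mu.-integrable Q (fun x => (normc (f x) ^+ 2)%:E).
  apply/integrableP; split; first exact: cmeasurable_norm.
  by under eq_integral => x _ do rewrite gee0_abs ?lee_fin ?sqr_ge0//.
have ar : approximableR int_freqs (fun x => Re (f x)).
  apply: approximableR_int => //; apply: le_integrable iE => //.
    exact/measurable_EFinP/measurable_funX.
  by move=> x _; rewrite /= lee_fin !ger0_norm ?sqr_ge0// sqr_normc_Re_Im lerDl sqr_ge0.
have ai : approximableR int_freqs (fun x => Im (f x)).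
  apply: approximableR_int => //; apply: le_integrable iE => //.
    exact/measurable_EFinP/measurable_funX.
  by move=> x _; rewrite /= lee_fin !ger0_norm ?sqr_ge0// sqr_normc_Re_Im lerDr sqr_ge0.
have := approximableD ar (approximableZ 'i%C ai).
by apply: eq_approximable => x _; rewrite -complexE.
Qed.

End density.

(** * Spectra and the Parseval identity *)

Section sinc_zeros.
Context {R : realType}.

(** The absolute value hides the change of sign at each unit step. *)
Lemma abs_sin_piD_int (v : R) (m : int) : `|sin (pi * (v + m%:~R))| = `|sin (pi * v)|.
Proof.
have H1 (w : R) : `|sin (pi * (w + 1))| = `|sin (pi * w)|.
  by rewrite mulrDr mulr1 sinDpi normrN.
have Hn (w : R) k : `|sin (pi * (w + k%:R))| = `|sin (pi * w)|.
  elim: k => [|k IH]; first by rewrite addr0.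
  by rewrite -natr1 addrA H1.
case: m => k; first exact: Hn.
by rewrite NegzE mulrNz -[RHS](Hn _ k.+1) -(Hn (v - _) k.+1) subrK Hn.
Qed.

Lemma sinc_int (v : R) : v \is a Num.int -> v != 0 -> sinc v = 0.
Proof.
move=> /intrP[m ->] v0; rewrite /sinc (negPf v0).
have := abs_sin_piD_int 0 m; rewrite add0r mulr0 sin0 normr0 => /eqP.
by rewrite normr_eq0 => /eqP ->; rewrite mul0r.
Qed.

(** Subtracting the floor reduces to the fractional part [t], for which [sin (pi * t)] is positive
    unless [t = 0]. *)
Lemma sinc_eq0 (v : R) : sinc v = 0 -> v \is a Num.int /\ v != 0.
Proof.
rewrite /sinc; have [_ /eqP|v0 /eqP] := eqVneq v 0; first by rewrite oner_eq0.
rewrite mulf_eq0 invr_eq0 mulf_eq0 (negPf v0) (gt_eqF (pi_gt0 R)) !orbF => /eqP s0.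
split => //; have := abs_sin_piD_int v (- Num.floor v); rewrite s0 normr0 mulrNz => /eqP.
have := floor_le v; have := floorD1_gt v; rewrite intrD.
rewrite normr_eq0 => h1 h2 h3.
have [->|h4] := eqVneq v (Num.floor v)%:~R; first exact: intr_int.
have : 0 < sin (pi * (v - (Num.floor v)%:~R)).
  apply: sin_pi_gt0; rewrite subr_gt0 ltrBlDl h1 andbT.
  by rewrite lt_neqAle eq_sym h4.
by rewrite (eqP h3) ltxx.
Qed.

End sinc_zeros.

Section spectra.
Context {R : realType} {n : nat}.
Local Notation Q := (@open_unit_cube R n).
Local Notation mu := (lebesgue_rV n).
Local Notation normc := ComplexField.Normc.normc.
Implicit Types (u v : 'rV[R]_n) (S : set 'rV[R]_n).

Lemma cube_sinc_eq0 v : cube_sinc v = 0 ->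
  exists i, v ord0 i \is a Num.int /\ v ord0 i != 0.
Proof.
move=> /eqP/prodf_eq0[i _ /eqP/sinc_eq0 vi]; by exists i.
Qed.

Lemma cube_sinc_int v i : v ord0 i \is a Num.int -> v ord0 i != 0 -> cube_sinc v = 0.
Proof. by move=> iv v0; rewrite /cube_sinc (bigD1 i)//= sinc_int// mul0r. Qed.

Lemma orthogonal_int_freqs : orthogonal_freqs (@int_freqs R n).
Proof.
move=> u v iu iv /eqP uv.
have [i uvi] : exists i, u ord0 i != v ord0 i.
  apply/not_existsP => H; apply: uv; apply/rowP => i.
  by apply/eqP; apply: contra_notT (H i).
by apply: (@cube_sinc_int _ i); rewrite !mxE ?rpredB// subr_eq0.
Qed.

Lemma energy_expo v : energy (expo v) = 1%E.
Proof.
rewrite /energy; under eq_integral => x _ do rewrite normc_expo expr1n.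
transitivity (1%:E * lebesgue_rV n Q)%E.
  by apply: integral_cst; exact: measurable_open_unit_cube.
by rewrite lebesgue_open_unit_cube mule1.
Qed.

Lemma L2_expo v : L2 mu Q (expo v).
Proof. by apply/L2P; split; [exact: cmeasurable_expo|rewrite energy_expo ltry]. Qed.

(** Density puts every [expo v] in the closure, and [parsevalP] converts this into the identity. *)
Lemma int_freqs_parseval v :
  (\esum_(i in int_freqs) (cube_sinc (v - i) ^+ 2)%:E = 1)%E.
Proof.
apply/(parsevalP _ orthogonal_int_freqs).
exact/L2_approximable/L2_expo.
Qed.

(** At [v = u] the term of index [u] is already 1, so every other term vanishes. *)
Lemma esum1_orthogonal S :
  (forall v, S v -> (\esum_(i in S) (cube_sinc (v - i) ^+ 2)%:E = 1)%E) ->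
  orthogonal_freqs S.
Proof.
move=> H u v Su Sv uv.
have := @sum_seq_le_esum _ _ S (fun i => (cube_sinc (u - i) ^+ 2)%:E) [:: u; v].
rewrite H// sumEFin !big_cons big_nil subrr cube_sinc0 expr1n addr0 lee_fin gerDl.
rewrite /= inE uv => /(_ isT); move=> K; apply/eqP; rewrite -sqrf_eq0 eq_le sqr_ge0 andbT.
by apply: K => i; rewrite !inE => /orP[] /eqP ->.
Qed.

(** A spectrum approximates each [expo v], which is Parseval's identity at [v]. Conversely the
    identities approximate all exponentials, in particular those of integer frequency, and these are
    dense. *)
Lemma is_spectrumP S : is_spectrum Q S <->
  forall v, (\esum_(i in S) (cube_sinc (v - i) ^+ 2)%:E = 1)%E.
Proof.
split=> [[_ oS aS]|H].
  have o : orthogonal_freqs S.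
    move=> u v Su Sv uv; have := oS u v Su Sv.
    by rewrite L2_inner_expo (negPf uv) => -[].
  move=> v; apply/(parsevalP _ o); split; first exact: cmeasurable_expo.
  move=> e e0; have se0 : 0 < Num.sqrt e by rewrite sqrtr_gt0.
  have [s [c [sS]]] := aS _ (L2_expo v) _ se0.
  rewrite L2_norm_lt// sqr_sqrtr ?ltW// => E.
  exists (fun x => \sum_(i <- s) c i * expo i x) => //.
  exists [seq (c i, i) | i <- s]; split; last by move=> x; rewrite big_map.
  by move=> _ /mapP[i si ->]; exact: sS.
have o : orthogonal_freqs S by apply: esum1_orthogonal => v _; exact: H.
split.
- by move=> i _; exact: L2_expo.
- move=> u v Su Sv; rewrite L2_inner_expo.
  have [->|uv] := eqVneq u v; first by rewrite subrr cube_sinc0.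
  by rewrite o.
- move=> f /L2_approximable af e e0.
  have [_ /(_ (e ^+ 2))] : approximable S f.
    by apply: approximable_trans af _ => v _; apply/parsevalP.
  case; first by rewrite exprn_gt0.
  move=> g /trigpoly_collect[s [c [us sS /funext->]]] E.
  by exists s, c; split => //; rewrite L2_norm_lt.
Qed.

End spectra.

(** Dimension 1 of [int_freqs_parseval]; for [t] not an integer this is the classical expansion of
    [pi^2 / sin^2 (pi t)] as the sum of the [(t - k)^(-2)]. *)
Lemma sinc_parseval {R : realType} (t : R) :
  (\esum_(k in [set: int]) (sinc (t - k%:~R) ^+ 2)%:E = 1)%E.
Proof.
rewrite -(int_freqs_parseval (const_mx t : 'rV[R]_1)).
rewrite (@reindex_esum _ _ _ setT int_freqs (fun k : int => const_mx k%:~R : 'rV[R]_1)).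
- apply: eq_esum => k _; rewrite /cube_sinc big_ord1 !mxE//.
- split.
  + by move=> k _ i; rewrite mxE intr_int.
  + move=> k l _ _ /rowP/(_ ord0); rewrite !mxE => /eqP.
    by rewrite eqr_int => /eqP.
  + move=> v iv; have /intrP[m vm] := iv ord0; exists m => //.
    by apply/rowP => i; rewrite mxE (ord1 i).
Qed.

(** * From spectra to tilings *)

Section countable_sums.
Context {R : realType} d (T : measurableType d) (mu : {measure set T -> \bar R}).
Context {J : choiceType} (S : set J).
Local Open Scope ereal_scope.

(** One enumeration serves all nonnegative families, so it can be fixed before the family depends on
    a point of [T]; [None] pads with zero terms. *)
Lemma esum_countable : countable S -> exists e : nat -> option J,
  forall a : J -> \bar R, (forall l, 0 <= a l) ->
    \esum_(l in S) a l = \sum_(k <oo) oapp a 0 (e k).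
Proof.
move=> /countable_injP[f fI].
pose P k l := S l /\ f l = k.
pose e k := if pselect (exists l, P k l) is left H then Some (projT1 (cid H)) else None.
have eS l : S l -> e (f l) = Some l.
  move=> Sl; rewrite /e; case: pselect => [H|H]; last by exfalso; apply: H; exists l.
  case: cid => l' [Sl' fl']/=; congr Some.
  by apply: fI => //; rewrite inE.
exists e => a a0; pose b k := oapp a 0 (e k).
rewrite nneseries_esumT; last by move=> k; case: (e k) => [l|] /=.
transitivity (\esum_(l in S) b (f l)).
  by apply: eq_esum => l Sl; rewrite /b eS.
rewrite -(esum_image S f b fI).
rewrite esum_mkcond; apply: eq_esum => k _; rewrite /b /e.
case: ifPn => // kfS; case: pselect => // -[l [Sl fl]].
by exfalso; move: kfS; rewrite notin_setE; apply; exists l.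
Qed.

Lemma esumZr (a : J -> \bar R) (c : R) : countable S -> (0 <= c)%R ->
  (forall l, 0 <= a l) ->
  (\esum_(l in S) a l) * c%:E = \esum_(l in S) (a l * c%:E).
Proof.
move=> /esum_countable[e eE] c0 a0.
rewrite !eE//; last by move=> l; rewrite mule_ge0.
rewrite muleC -nneseriesZl//; last by move=> k _; case: (e k) => //=.
by apply: eq_eseriesr => k _; case: (e k) => [l|] //=; rewrite ?mule0// muleC.
Qed.

Lemma measurable_fun_esum (f : J -> T -> \bar R) (D : set T) : countable S ->
  (forall l, measurable_fun D (f l)) -> (forall l x, 0 <= f l x) ->
  measurable_fun D (fun x => \esum_(l in S) f l x).
Proof.
move=> /esum_countable[e eE] mf f0.
under eq_fun do rewrite eE//.
apply: (@ge0_emeasurable_sum _ _ _ _ (fun k x => oapp (f^~ x) 0 (e k)) xpredT).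
  by move=> k x _ _; case: (e k) => //=.
by move=> k _; case: (e k) => [l|] //=.
Qed.

Lemma integral_esum (f : J -> T -> \bar R) (D : set T) : countable S -> measurable D ->
  (forall l, measurable_fun D (f l)) -> (forall l x, 0 <= f l x) ->
  \int[mu]_(x in D) (\esum_(l in S) f l x) = \esum_(l in S) \int[mu]_(x in D) f l x.
Proof.
move=> /esum_countable[e eE] mD mf f0.
rewrite eE; last by move=> l; exact: integral_ge0.
under eq_integral => x _ do rewrite eE//.
rewrite integral_nneseries//.
- apply: eq_eseriesr => k _; case: (e k) => [l|] //=.
  exact: integral0.
- by move=> k; case: (e k) => [l|] //=.
- by move=> k x _; case: (e k) => [l|] //=.
Qed.

End countable_sums.

(** * Separated sets, packings by cubes, and tiling from the Parseval identities *)

Section separated.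
Context {R : realType} {n : nat}.
Local Notation Q := (@open_unit_cube R n).
Local Notation mu := (lebesgue_rV n).
Implicit Types (u v x y : 'rV[R]_n) (S : set 'rV[R]_n).

(** Equivalently, translates of the open unit cube by distinct elements of [S] are disjoint. *)
Definition separated_freqs S :=
  forall u v, S u -> S v -> u != v -> exists i, 1 <= `|u ord0 i - v ord0 i|.

Lemma orthogonal_separated S : orthogonal_freqs S -> separated_freqs S.
Proof.
move=> oS u v Su Sv uv; have [i []] := cube_sinc_eq0 (oS u v Su Sv uv).
by rewrite !mxE => iuv uv0; exists i; rewrite norm_intr_ge1.
Qed.

Definition floor_rV v : 'rV[int]_n := map_mx Num.floor v.

(** Points of the same integer cell differ by less than 1 in every coordinate. *)
Lemma separated_floor_inj S : separated_freqs S -> {in S &, injective floor_rV}.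
Proof.
move=> sS u v /[!inE] Su Sv uv; apply/eqP; apply: contraT => u_neq_v.
have [j ge1] := sS u v Su Sv u_neq_v; move: ge1.
have := floor_le (u ord0 j); have := floorD1_gt (u ord0 j).
have := floor_le (v ord0 j); have := floorD1_gt (v ord0 j).
have -> : Num.floor (u ord0 j) = Num.floor (v ord0 j).
  by have /rowP/(_ j) := uv; rewrite !mxE.
by rewrite intrD; move: (_%:~R) => m; rewrite ler_normr; lra.
Qed.

Lemma separated_countable S : separated_freqs S -> countable S.
Proof.
move=> sS; apply/countable_injP; exists (pickle \o floor_rV) => u v Su Sv /=.
by move=> /(pcan_inj pickleK); exact: (separated_floor_inj sS).
Qed.

Lemma int_freqs_separated : separated_freqs (@int_freqs R n).
Proof. exact/orthogonal_separated/orthogonal_int_freqs. Qed.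

(** Two translates containing [y] would put their centres at distance less than 1 in every
    coordinate. A general [D] covers both the open and the half-open cube. *)
Lemma packing_le1 S (D : set 'rV[R]_n) y : separated_freqs S ->
  (forall u v i, D u -> D v -> `|u ord0 i - v ord0 i| < 1) ->
  (\esum_(l in S) (\1_D (y - l)%R : R)%:E <= 1)%E.
Proof.
move=> sS D1; apply: esum_le_seq => s us sSs.
rewrite sumEFin lee_fin.
have [/hasP[l ls yl]|/hasPn H] := boolP (has (fun l => (y - l) \in D) s); last first.
  rewrite big_seq big1// => l ls; rewrite indicE.
  by have := H l ls => /negPf ->.
rewrite (bigD1_seq l)//= indicE yl big_seq_cond big1 ?addr0// => k /andP[ks kl].
rewrite indicE memNset// => yk; move: yl; rewrite inE => yl.
have [i ge1] := sS k l (sSs _ ks) (sSs _ ls) kl; move: ge1.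
have := D1 _ _ i yl yk; rewrite !mxE => h1.
rewrite (_ : k ord0 i - l ord0 i = y ord0 i - l ord0 i - (y ord0 i - k ord0 i)).
  by rewrite leNgt h1.
by ring.
Qed.

Lemma cube_packing S y : separated_freqs S ->
  (\esum_(l in S) (\1_Q (y - l)%R : R)%:E <= 1)%E.
Proof.
move=> sS; apply: packing_le1 => // u v i uQ vQ.
by have := uQ i; have := vQ i; rewrite ltr_norml; lra.
Qed.

Lemma measurable_sinc : measurable_fun setT (@sinc R).
Proof.
rewrite -(setUv [set (0 : R)]); apply/measurable_funU => //.
  exact: measurableC.
split; first exact: measurable_fun_set1.
apply: (eq_measurable_fun (fun v : R => sin (pi * v) / (pi * v))).
  by move=> v; rewrite inE /= /sinc => /eqP /negPf ->.
apply: open_continuous_measurable_fun.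
  by rewrite openC; exact: closed_eq.
move=> v; rewrite inE/= => /eqP v0; apply: cvgM.
  apply: (@continuous_comp _ _ _ ( *%R pi) sin); first exact: mulrl_continuous.
  exact: continuous_sin.
apply: cvgV; last exact: mulrl_continuous.
by rewrite mulf_neq0// gt_eqF// pi_gt0.
Qed.

Lemma measurable_cube_sinc : measurable_fun setT (@cube_sinc R n).
Proof.
apply: measurable_prod => i _; apply: measurableT_comp; first exact: measurable_sinc.
exact: measurable_rV_coord.
Qed.

(** The zeros lie on the countably many hyperplanes where a coordinate takes an integer value. *)
Lemma cube_sinc_neq0_ae : {ae mu, forall x, cube_sinc x != 0}.
Proof.
pose F k : set 'rV[R]_n := if @unpickle ('I_n * int)%type k is Some p
  then [set x : 'rV[R]_n | x ord0 p.1 = p.2%:~R] else set0.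
apply: (@negligibleS _ _ _ mu (\bigcup_k F k)).
  move=> x /= /negP; rewrite negbK => /eqP/cube_sinc_eq0[i [/intrP[m xi] _]].
  by exists (pickle (i, m)) => //; rewrite /F pickleK.
apply: negligible_bigcup => k; rewrite /F; case: unpickle => [p|].
  apply/negligibleP; first exact: measurable_hyperplane.
  exact: hyperplane_null.
exact: negligible_set0.
Qed.

(** Unlike those of the open cube, its integer translates cover every point. *)
Definition half_open_cube : set 'rV[R]_n := [set x | forall i, - 2^-1 <= x ord0 i < 2^-1].

Lemma half_open_cubeE : half_open_cube =
  [set x | forall i, `[- 2^-1, 2^-1[%classic (x ord0 i)].
Proof.
by apply/seteqP; split => x /= h i; have := h i; rewrite in_itv.
Qed.

Lemma measurable_half_open_cube : measurable half_open_cube.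
Proof.
by rewrite half_open_cubeE; exact: (@measurable_rV_box R n (fun=> `[- 2^-1, 2^-1[%classic)).
Qed.

Lemma lebesgue_half_open_cube : mu half_open_cube = 1%E.
Proof.
rewrite half_open_cubeE (@lebesgue_rV_box R n (fun=> `[- 2^-1, 2^-1[%classic))//.
rewrite big1// => i _; rewrite lebesgue_measure_itv/= lte_fin.
by rewrite gtrN ?invr_gt0// -EFinB; congr _%:E; lra.
Qed.

Lemma half_open_cube_cover y :
  (1 <= \esum_(l in int_freqs) (\1_half_open_cube (y - l)%R : R)%:E)%E.
Proof.
(* Rounding to a nearest integer; the floor of [y + 1/2] leaves a remainder in [-1/2, 1/2). *)
pose l : 'rV[R]_n := \row_i (Num.floor (y ord0 i + 2^-1))%:~R.
have lZ : int_freqs l by move=> i; rewrite mxE intr_int.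
have := @sum_seq_le_esum _ _ int_freqs
  (fun l => (\1_half_open_cube (y - l)%R : R)%:E) [:: l] isT.
rewrite big_seq1 indicE mem_set; first by apply => i; rewrite inE => /eqP ->.
move=> i; rewrite !mxE.
have := floor_le (y ord0 i + 2^-1); have := floorD1_gt (y ord0 i + 2^-1).
by rewrite intrD; move: (_%:~R) => m; lra.
Qed.

Local Open Scope ereal_scope.

(* Unfolding: both sides are the sum over [l] of the integral of [g] over [l + D]. *)
Lemma integral_tiles S (D : set 'rV[R]_n) (g : 'rV[R]_n -> R) : countable S ->
  measurable D -> measurable_fun setT g -> (forall x, (0 <= g x)%R) ->
  \int[mu]_y ((\esum_(l in S) (\1_D (y - l)%R : R)%:E) * (g y)%:E) =
  \int[mu]_(z in D) \esum_(l in S) (g (z + l)%R)%:E.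
Proof.
move=> cS mD mg g0.
have mgl (l : 'rV[R]_n) : measurable_fun setT (fun z : 'rV[R]_n => g (z + l)%R).
  exact: (measurableT_comp mg (measurable_rV_shift l)).
have mDl (l : 'rV[R]_n) : measurable ((fun y : 'rV[R]_n => (y - l)%R) @^-1` D).
  by rewrite -[X in measurable X]setTI; exact: measurable_rV_shift.
have E (l : 'rV[R]_n) : (fun y : 'rV[R]_n => (\1_D (y - l)%R * g y)%:E) =
    (EFin \o g) \_ ((fun y : 'rV[R]_n => (y - l)%R) @^-1` D).
  apply/funext => y; rewrite /patch indicE.
  rewrite (_ : (y \in _) = (y - l \in D)%R); last by apply/idP/idP; rewrite !inE.
  by case: ifP => _; rewrite ?mul1r ?mul0r.
have mE (l : 'rV[R]_n) : measurable_fun setT (fun y : 'rV[R]_n => (\1_D (y - l)%R * g y)%:E).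
  rewrite E; apply: (measurable_restrictT _ (mDl l)).1.
  by apply: measurable_funTS; exact/measurable_EFinP.
under eq_integral => y _ do rewrite esumZr//.
under eq_integral => y _ do under eq_esum => l _ do rewrite -EFinM.
rewrite integral_esum//.
- rewrite integral_esum//.
  + apply: eq_esum => l _; rewrite E -integral_mkcond.
    rewrite -(@ge0_integral_rV_shift _ _ (- l)%R (fun z => (g (z + l)%R)%:E) D)//.
    * by apply: eq_integral => y _; rewrite subrK.
    * by apply: measurable_funTS; exact/measurable_EFinP.
    * by move=> x _; rewrite lee_fin.
  + by move=> l; apply: measurable_funTS; exact/measurable_EFinP.
  + by move=> l x; rewrite lee_fin.
- by move=> l y; rewrite lee_fin mulr_ge0// indicE.
Qed.

Lemma measurable_tile (D : set 'rV[R]_n) l : measurable D ->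
  measurable_fun setT (fun y => (\1_D (y - l)%R : R)%:E).
Proof.
move=> mD; apply/measurable_EFinP.
have mi : measurable_fun setT (\1_D : 'rV[R]_n -> R) by exact: measurable_indic.
exact: (measurableT_comp mi (measurable_rV_shift (- l)%R)).
Qed.

(** Integer translates of the half-open cube cover the space, so the integral is at most its folding
    onto one such cube, where [int_freqs_parseval] makes the integrand 1. *)
Lemma integral_cube_sinc_le1 : \int[mu]_y (cube_sinc (y : 'rV[R]_n) ^+ 2)%:E <= 1.
Proof.
have cZ := separated_countable int_freqs_separated.
have mg : measurable_fun setT (fun y : 'rV[R]_n => (cube_sinc y ^+ 2)%R).
  by apply: measurable_funX; exact: measurable_cube_sinc.
have g0 (y : 'rV[R]_n) : (0 <= cube_sinc y ^+ 2)%R by exact: sqr_ge0.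
have H := integral_tiles cZ measurable_half_open_cube mg g0.
have : \int[mu]_(z in half_open_cube)
    (\esum_(l in int_freqs) (cube_sinc (z + l)%R ^+ 2)%:E) = 1.
  under eq_integral => z _.
    (* Evenness replaces [z + l] by [- z - l], so that the identity applies at [- z]. *)
    under eq_esum => l _ do rewrite -cube_sincN opprD.
    rewrite int_freqs_parseval; over.
  rewrite integral_cst; last exact: measurable_half_open_cube.
  by rewrite mul1e; exact: lebesgue_half_open_cube.
move=> <-; rewrite -H; apply: ge0_le_integral => //.
- by move=> y _; rewrite lee_fin.
- exact/measurable_EFinP.
- apply: emeasurable_funM; last exact/measurable_EFinP.
  apply: measurable_fun_esum => // l; exact: (measurable_tile _ measurable_half_open_cube).
- by move=> y _; rewrite lee_pemull ?lee_fin//; exact: half_open_cube_cover.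
Qed.

Lemma parseval_tiling S :
  (forall v, \esum_(i in S) (cube_sinc (v - i)%R ^+ 2)%:E = 1) ->
  is_tiling Q S.
Proof.
move=> H; have sS := orthogonal_separated (esum1_orthogonal (fun v _ => H v)).
have cS := separated_countable sS.
have mQ : measurable Q by exact: measurable_open_unit_cube.
pose G (y : 'rV[R]_n) := (cube_sinc y ^+ 2)%R.
have mG : measurable_fun setT G.
  by apply: measurable_funX; exact: measurable_cube_sinc.
have G0 (y : 'rV[R]_n) : (0 <= G y)%R by exact: sqr_ge0.
pose F (y : 'rV[R]_n) := \esum_(l in S) (\1_Q (y - l)%R : R)%:E.
have F0 y : 0 <= F y by apply: esum_ge0 => l _; rewrite lee_fin indicE.
have F1 y : F y <= 1 by exact: cube_packing.
have mF : measurable_fun setT F.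
  by apply: measurable_fun_esum => // l; exact: measurable_tile.
have IF : \int[mu]_y (F y * (G y)%:E) = 1.
  rewrite integral_tiles//.
  under eq_integral => z _.
    under eq_esum => l _ do rewrite /G -cube_sincN opprD.
    rewrite H; over.
  rewrite integral_cst// mul1e; exact: lebesgue_open_unit_cube.
have fF y : F y \is a fin_num by rewrite ge0_fin_numE// (le_lt_trans (F1 y)) ?ltry.
have h0 y : 0 <= (1 - F y) * (G y)%:E by rewrite mule_ge0 ?lee_fin// sube_ge0 ?fF.
have mh : measurable_fun setT (fun y => (1 - F y) * (G y)%:E).
  apply: emeasurable_funM; last exact/measurable_EFinP.
  exact: emeasurable_funB.
(* The integral of [G], at most 1, is the sum of that of [F * G], equal to 1, and of this
   nonnegative one. *)
have Ih : \int[mu]_y ((1 - F y) * (G y)%:E) = 0.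
  apply/eqP; rewrite eq_le integral_ge0 ?andbT//.
  have := integral_cube_sinc_le1.
  have -> : \int[mu]_y (cube_sinc (y : 'rV[R]_n) ^+ 2)%:E =
      \int[mu]_y (F y * (G y)%:E + (1 - F y) * (G y)%:E).
    apply: eq_integral => y _; rewrite -/(G y).
    move: (fF y); case: (F y) => // r _; rewrite -EFinB -!EFinM -EFinD; congr _%:E; ring.
  rewrite ge0_integralD//; last 2 first.
  - by move=> y _; rewrite mule_ge0 ?lee_fin.
  - by apply: emeasurable_funM => //; exact/measurable_EFinP.
  by rewrite IF -[leRHS]adde0 leeD2lE.
have [+ _] := ae_eq_integral_abs mu measurableT mh.
under eq_integral => y _ do rewrite gee0_abs//.
move=> /(_ Ih) ae0; rewrite /is_tiling.
apply: filterS2 ae0 cube_sinc_neq0_ae => y /(_ I) /= + y0 => /eqP.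
rewrite mule_eq0 orbC eqe sqrf_eq0 (negPf y0)/= => /eqP.
rewrite -/(F y); move: (fF y); case: (F y) => // r _; rewrite -EFinB => -[] /eqP.
by rewrite subr_eq0 => /eqP <-.
Qed.

End separated.

(** * From tilings to spectra *)

Lemma esum_fiber {R : realType} {J K : choiceType} (S : set J) (theta : J -> K)
    (F : J -> \bar R) :
  (forall l, 0 <= F l)%E ->
  (\esum_(l in S) F l =
   \esum_(k in [set: K]) \esum_(l in [set l | S l /\ theta l = k]) F l)%E.
Proof.
move=> F0; rewrite esum_esum//.
rewrite (@reindex_esum _ _ _ S _ (fun l => (theta l, l)))//=; split.
- by move=> l Sl.
- by move=> l l' _ _ [].
- by move=> [k l] /= [_ [Sl <-]]; exists l.
Qed.

(** * Discrete measures on the line giving mass 1 to every unit window *)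

Section unit_windows.
Context {R : realType} {J : choiceType} (S : set J).
Variables (a : J -> R) (w : J -> R).
Hypotheses (cS : countable S) (w0 : forall l, 0 <= w l).
Local Open Scope ereal_scope.

(* The discrete measure with mass [w l] at the point [a l]. *)
Definition mass (A : set R) : \bar R := \esum_(l in [set l | S l /\ A (a l)]) (w l)%:E.

Lemma mass_ge0 A : 0 <= mass A.
Proof. by apply: esum_ge0 => l _; rewrite lee_fin. Qed.

Lemma massID A B : mass A = mass (A `&` B) + mass (A `\` B).
Proof.
rewrite /mass (esumID [set l | B (a l)]); last by move=> l _; rewrite lee_fin.
by congr (_ + _); congr esum; apply/seteqP; split=> l /=;
  [case=> -[]|case=> ? []|case=> -[]|case=> ? []].
Qed.

Lemma massU A B : A `&` B = set0 -> mass (A `|` B) = mass A + mass B.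
Proof.
move=> AB0; rewrite (massID _ A); congr (mass _ + mass _).
  by apply/seteqP; split=> x /=; tauto.
have AB x : A x -> B x -> False by move=> Ax Bx; have : (A `&` B) x by []; rewrite AB0.
by apply/seteqP; split=> x /=; [tauto|move=> Bx; split; [right|move/AB; exact]].
Qed.

Lemma le_mass A B : A `<=` B -> mass A <= mass B.
Proof.
move=> AB; rewrite (massID B A) (_ : B `&` A = A).
  by rewrite leeDl// mass_ge0.
by apply/setIidPr.
Qed.

Hypothesis window : forall t : R, mass `]t, (t + 1)%R]%classic = 1.

(* There may be infinitely many atoms in a bounded interval, but almost all of their mass
   is carried by finitely many of them. *)
Lemma mass_left_limit (u e : R) : (0 < e)%R ->
  exists s : R, (u - 1 <= s < u)%R /\ mass `]s, u[%classic <= e%:E.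
Proof.
move=> e0; pose A : set R := `](u - 1)%R, u[%classic.
have A1 : mass A <= 1.
  rewrite -(window (u - 1)%R) subrK; apply: le_mass => x; rewrite /A /= !in_itv/=.
  by move=> /andP[-> /ltW].
have fA : mass A \is a fin_num by rewrite ge0_fin_numE ?mass_ge0// (le_lt_trans A1)// ltry.
have : mass A - e%:E < mass A.
  by rewrite lteBlDr// lteDl// lte_fin.
rewrite {2}/mass => /lt_esum_seq[s [us sA]] H.
(* The rightmost of finitely many atoms that carry all but [e] of the mass of [A], or [u - 1] if
   there are none. *)
pose m : R := foldr (fun l => Num.max (a l)) (u - 1)%R s.
have m1 : (u - 1 <= m < u)%R.
  rewrite /m; elim: s sA {us H m} => [|l s IH] sA /=.
    by rewrite lexx ltrBlDr ltrDl ltr01.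
  have [|h1 h2] := andP (IH _); first by move=> i si; apply: sA; rewrite inE si orbT.
  rewrite le_max h1 orbT gt_max h2 andbT.
  by have [_] := sA l (mem_head _ _); rewrite /A/= in_itv/= => /andP[].
have ms l : l \in s -> (a l <= m)%R.
  rewrite /m; elim: s {us sA H m m1} => //= k s IH; rewrite inE => /predU1P[->|/IH h].
    by rewrite le_max lexx.
  by rewrite le_max h orbT.
exists m; split=> //; case/andP: m1 => m1 m2.
have E : mass A = mass `](u - 1)%R, m]%classic + mass `]m, u[%classic.
  rewrite -massU; last first.
    by apply/seteqP; split=> x //=; rewrite !in_itv/= => -[/andP[_ h1] /andP[h2 _]]; lra.
  congr mass; apply/seteqP; split => x; rewrite /A/= !in_itv/=.
    by move=> /andP[h1 h2]; have [xm|xm] := leP x m; [left|right]; apply/andP; split.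
  by case=> /andP[h1 h2]; apply/andP; split=> //; lra.
have Hs : \sum_(l <- s) (w l)%:E <= mass `](u - 1)%R, m]%classic.
  apply: sum_seq_le_esum => // l ls; have [Sl Aal] := sA l ls; split => //.
  by move: Aal; rewrite /A/= !in_itv/= => /andP[-> _]/=; exact: ms.
move: H E Hs; rewrite sumEFin => H E Hs.
have : mass `]m, u[%classic <= mass A by rewrite E leeDr// mass_ge0.
have : mass `](u - 1)%R, m]%classic <= mass A by rewrite E leeDl// mass_ge0.
move: fA H E Hs (mass_ge0 `]m, u[%classic).
case: (mass A) => // x _; case: (mass `](u - 1)%R, m]%classic) => // y;
  case: (mass `]m, u[%classic) => // z.
rewrite -!EFinD !lte_fin !lee_fin => H [xE]; move: H; rewrite xE.
by move: (\sum_(_ <- _) _)%R => v; lra.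
Qed.

Lemma mass_window_fin (t : R) A : A `<=` `]t, (t + 1)%R]%classic -> mass A \is a fin_num.
Proof.
move=> /le_mass; rewrite window => A1.
by rewrite ge0_fin_numE ?mass_ge0// (le_lt_trans A1)// ltry.
Qed.

Lemma mass_split (x y z : R) : (x <= y)%R -> (y <= z)%R ->
  mass `]x, z]%classic = mass `]x, y]%classic + mass `]y, z]%classic.
Proof.
move=> xy yz; rewrite -massU.
  congr mass; apply/seteqP; split => t; rewrite /= !in_itv/=.
    by move=> /andP[h1 h2]; have [ty|ty] := leP t y; [left|right]; apply/andP; split.
  by case=> /andP[h1 h2]; apply/andP; split=> //; lra.
by apply/seteqP; split=> t //=; rewrite !in_itv/= => -[/andP[_ h1] /andP[h2 _]]; lra.
Qed.

(** The windows starting at [s] and at [u] both have mass 1; cancelling their common part []s, s +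
    1]]&[]u, u + 1]], of finite mass, leaves the two sides. *)
Lemma mass_shift (s u : R) : (s <= u <= s + 1)%R ->
  mass `]s, u]%classic = mass `](s + 1)%R, (u + 1)%R]%classic.
Proof.
move=> /andP[su us].
have E1 := mass_split su us; have E2 := mass_split us (lerD su (lexx 1)%R).
move: E1 E2; rewrite !window.
have f1 : mass `]s, u]%classic \is a fin_num.
  by apply: (@mass_window_fin s) => x; rewrite /= !in_itv/= => /andP[-> h]/=; lra.
have f2 : mass `]u, (s + 1)%R]%classic \is a fin_num.
  by apply: (@mass_window_fin s) => x; rewrite /= !in_itv/= => /andP[h ->]; rewrite andbT; lra.
have f3 : mass `](s + 1)%R, (u + 1)%R]%classic \is a fin_num.
  by apply: (@mass_window_fin u) => x; rewrite /= !in_itv/= => /andP[h ->]; rewrite andbT; lra.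
move: f1 f2 f3; do 3 (case: (mass _) => // ? _).
by rewrite -!EFinD => -[E1] [E2]; congr _%:E; lra.
Qed.

Lemma mass_setU1 (s u : R) : (s < u)%R ->
  mass `]s, u]%classic = mass `]s, u[%classic + mass [set u].
Proof.
move=> su; rewrite -massU.
  congr mass; apply/seteqP; split => t; rewrite /= !in_itv/=.
    by rewrite le_eqVlt => /andP[h1 /predU1P[->|h2]]; [right|left; rewrite h1].
  by case=> [/andP[-> /ltW]|->]//; rewrite su lexx.
by apply/seteqP; split=> t //=; rewrite in_itv/= => -[+ tu]; rewrite tu ltxx andbF.
Qed.

(** An atom lies at the right end of a short interval []s, u]], whose mass is kept by the shift.
    With [s] from [mass_left_limit], this interval weighs at most [e] more than its end point. *)
Lemma mass_atom_shift (u : R) : mass [set u] = mass [set (u + 1)%R].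
Proof.
apply/eqP; rewrite eq_le; apply/andP; split; apply/lee_addgt0Pr => e e0.
  have [s [/andP[s1 s2] He]] := mass_left_limit (u + 1)%R e0.
  have s3 : (s - 1 < u)%R by rewrite ltrBlDr.
  have E : mass `](s - 1)%R, u]%classic = mass `]s, (u + 1)%R]%classic.
    by rewrite mass_shift ?subrK//; apply/andP; split; lra.
  apply: (@le_trans _ _ (mass `](s - 1)%R, u]%classic)).
    by apply: le_mass => x /= ->; rewrite in_itv/= s3 lexx.
  by rewrite E mass_setU1// addeC leeD2l.
have [s [/andP[s1 s2] He]] := mass_left_limit u e0.
have E : mass `]s, u]%classic = mass `](s + 1)%R, (u + 1)%R]%classic.
  by apply: mass_shift; apply/andP; split; lra.
apply: (@le_trans _ _ (mass `](s + 1)%R, (u + 1)%R]%classic)).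
  by apply: le_mass => x /= ->; rewrite in_itv/= lexx ltrD2r s2.
by rewrite -E mass_setU1// addeC leeD2l.
Qed.

Lemma mass_atom_shift_int (u : R) (k : int) : mass [set u] = mass [set (u + k%:~R)%R].
Proof.
have Hn (v : R) m : mass [set v] = mass [set (v + m%:R)%R].
  elim: m => [|m IH]; first by rewrite addr0.
  by rewrite IH mass_atom_shift -natr1 addrA.
case: k => m; first exact: Hn.
by rewrite NegzE mulrNz (Hn (u - _)%R m.+1) subrK.
Qed.

(** Group the atoms by their class modulo the integers. By periodicity the class of [t] contributes
    the mass at [t] times the sum of the [h (x - t - k)], which is 1; the representatives together
    fill one window. *)
Lemma window_sum (h : R -> R) : (forall t, (0 <= h t)%R) ->
  (forall t, \esum_(k in [set: int]) (h (t - k%:~R)%R)%:E = 1) ->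
  forall x, \esum_(l in S) (w l * h (x - a l))%:E = 1.
Proof.
move=> h0 h1 x.
(* Windows are open on the left, so ceilings are the right choice: representatives fall in []-1,
   0]]. *)
pose k l := Num.ceil (a l); pose r l := (a l - (k l)%:~R)%R.
have F0 l : 0 <= (w l * h (x - a l))%:E by rewrite lee_fin mulr_ge0.
rewrite (esum_fiber S r F0).
have rI l : (-1 < r l <= 0)%R.
  rewrite /r /k; have := ceil_itv (a l); rewrite intrB.
  by move: (Num.ceil _)%:~R => m /andP[? ?]; apply/andP; split; lra.
have atomE (t : R) (m : int) : (-1 < t <= 0)%R ->
    [set l | (S l /\ r l = t) /\ k l = m] = [set l | S l /\ [set (t + m%:~R)%R] (a l)].
  move=> t01; apply/seteqP; split => l /=.
    by move=> [[Sl <-] <-]; split => //; rewrite /r subrK.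
  move=> [Sl al]; have kl : k l = m.
    rewrite /k al ceilDrz ?intr_int// intrKceil (_ : Num.ceil t = 0%R) ?add0r//.
    by apply/eqP; rewrite ceil_eq sub0r.
  by split => //; split => //; rewrite /r kl al addrK.
have cT A : countable [set l | S l /\ A l].
  by apply: sub_countable cS; apply: subset_card_le => l [].
(* Each class is replaced by its atom in []-1, 0]], singled out by [k l = 0]. *)
transitivity (\esum_(t in [set: R])
    \esum_(l in [set l | (S l /\ k l = 0%R) /\ r l = t]) (w l)%:E).
  apply: eq_esum => t _.
  have [t01|t01] := boolP (-1 < t <= 0)%R; last first.
    by rewrite !esum1// => l /= [_ E]; move: t01; rewrite -E rI.
  rewrite (_ : [set l | (S l /\ k l = 0%R) /\ r l = t] =
      [set l | S l /\ [set t] (a l)]); last first.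
    rewrite -[t in [set t]]addr0 -(atomE t 0%R t01).
    by apply/seteqP; split => l /=; tauto.
  rewrite -/(mass [set t]) (esum_fiber _ k F0).
  have mt : mass [set t] \is a fin_num.
    by apply: (@mass_window_fin (-1)%R) => y /= ->; rewrite in_itv/= addNr.
  transitivity (\esum_(m in [set: int])
      ((h (x - t - m%:~R)%R)%:E * (fine (mass [set t]))%:E)).
    apply: eq_esum => m _; rewrite fineK// (mass_atom_shift_int t m).
    rewrite (atomE t m t01) muleC /mass esumZr//.
    by apply: eq_esum => l [_ /= ->]; rewrite EFinM opprD addrA.
  have cZ : countable [set: int] by exact: countableP.
  rewrite -(esumZr cZ); first by rewrite h1 mul1e fineK.
    by rewrite fine_ge0// mass_ge0.
  by move=> m; rewrite lee_fin.
have w0E l : 0 <= (w l)%:E by rewrite lee_fin.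
rewrite -(esum_fiber [set l | S l /\ k l = 0%R] r w0E).
rewrite -[RHS](window (-1)%R) addNr /mass; congr esum.
apply/seteqP; split => l /= [Sl]; rewrite in_itv/= => H; split => //.
  by move/eqP: H; rewrite /k ceil_eq sub0r.
by apply/eqP; rewrite /k ceil_eq sub0r.
Qed.

End unit_windows.

(** * From almost-everywhere tilings to exact tilings by half-open cubes *)

Section tilings.
Context {R : realType} {n : nat}.
Local Notation Q := (@open_unit_cube R n).
Local Notation Q' := (@half_open_cube R n).
Local Notation mu := (lebesgue_rV n).
Implicit Types (u v x y : 'rV[R]_n) (S : set 'rV[R]_n).

(** A nonempty open box has positive measure, so it is not contained in a null set. *)
Lemma ae_box (P : 'rV[R]_n -> Prop) (b c : 'rV[R]_n) :
  {ae mu, forall x, P x} -> (forall i, b ord0 i < c ord0 i) ->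
  exists x, (forall i, b ord0 i < x ord0 i < c ord0 i) /\ P x.
Proof.
move=> [N [mN N0 PN]] bc; apply/not_existsP => H.
pose B : set 'rV[R]_n := [set x | forall i, `]b ord0 i, c ord0 i[%classic (x ord0 i)].
have mB : measurable B.
  exact: (@measurable_rV_box R n (fun i => `]b ord0 i, c ord0 i[%classic)).
have BN : B `<=` N.
  move=> x xB; apply: PN => /= Px; apply: (H x); split=> [i|]; last exact: Px.
  by have := xB i; rewrite /= in_itv.
have : (mu B <= mu N)%E by apply: le_measure; rewrite ?inE.
rewrite N0 leNgt => /negP; apply.
rewrite (@lebesgue_rV_box R n (fun i => `]b ord0 i, c ord0 i[%classic))//.
elim/big_ind: _ => // [|i _]; first by move=> p q p0 q0; exact: mule_gt0.
by rewrite lebesgue_measure_itv/= lte_fin bc -EFinD lte_fin subr_gt0.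
Qed.

(** Otherwise the translates at [u] and [v] overlap in the open box with corners [b] and [c], which
    contains a point where the tiling sum is 1 although two terms are 1. *)
Lemma tiling_separated S : is_tiling Q S -> separated_freqs S.
Proof.
move=> tS u v Su Sv uv; apply/not_existsP => H.
have uv1 i : `|u ord0 i - v ord0 i| < 1 by rewrite ltNge; apply/negP; exact: H.
pose b : 'rV[R]_n := \row_i (Num.max (u ord0 i) (v ord0 i) - 2^-1).
pose c : 'rV[R]_n := \row_i (Num.min (u ord0 i) (v ord0 i) + 2^-1).
have [i|x [xbc Fx]] := @ae_box _ b c tS.
  have := uv1 i; rewrite !mxE ltr_norml.
  by case: (leP (u ord0 i) (v ord0 i)) => h; lra.
have xu : Q (x - u).
  move=> i; have := xbc i; rewrite !mxE.
  by case: (leP (u ord0 i) (v ord0 i)) => h; lra.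
have xv : Q (x - v).
  move=> i; have := xbc i; rewrite !mxE.
  by case: (leP (u ord0 i) (v ord0 i)) => h; lra.
have := @sum_seq_le_esum _ _ S (fun l => (\1_Q (x - l)%R : R)%:E) [:: u; v].
rewrite Fx !big_cons big_nil !indicE !mem_set// adde0 -EFinD lee_fin gerDl ler10.
rewrite /= inE uv => /(_ isT) K; suff : false by [].
by apply: K => i; rewrite !inE => /orP[]/eqP ->.
Qed.

(** Floors relative to [x] separate these points, and each coordinate takes at most [2 r + 1]
    values. *)
Lemma separated_near_finite S x (r : nat) : separated_freqs S ->
  finite_set [set l | S l /\ forall i, `|x ord0 i - l ord0 i| <= r%:R].
Proof.
move=> sS; set A := [set l | _].
pose fl (l : 'rV[R]_n) i : int := Num.floor (l ord0 i - x ord0 i) + r%:Z.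
pose f (l : 'rV[R]_n) : {ffun 'I_n -> 'I_(2 * r).+1} := [ffun i => inord (absz (fl l i))].
have flA l i : A l -> 0 <= fl l i <= (2 * r)%N%:Z.
  move=> [_ /(_ i)]; rewrite ler_norml => /andP[h1 h2].
  have : (- r%:Z <= Num.floor (l ord0 i - x ord0 i)).
    by rewrite floor_ge_int mulrNz; lra.
  have : (Num.floor (l ord0 i - x ord0 i) < r.+1%:Z).
    by rewrite floor_lt_int intS intrD; lra.
  by rewrite /fl; lia.
have fA : {in A &, injective f}.
  move=> u v /[!inE] Au Av /ffunP fuv.
  apply/eqP; apply: contraT => uv; have [i ge1] := sS u v Au.1 Av.1 uv.
  have fluv : fl u i = fl v i.
    have := fuv i; rewrite !ffunE => /(congr1 val).
    have := flA u i Au; have := flA v i Av.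
    move: (fl u i) (fl v i) => p q hq hp.
    by rewrite /= !inordK; lia.
  move: ge1; have := floor_le (u ord0 i - x ord0 i); have := floorD1_gt (u ord0 i - x ord0 i).
  have := floor_le (v ord0 i - x ord0 i); have := floorD1_gt (v ord0 i - x ord0 i).
  have /addIr -> := fluv.
  by rewrite intrD; move: (_%:~R) => m; rewrite ler_normr; lra.
rewrite -(eq_finite_set (inj_card_eq fA)); exact: finite_finset.
Qed.

(** If no half-open cube contained [x], all open cubes would miss a small box with lower corner [x],
    since the lower faces belong to the half-open cubes; but almost every point of the box is
    covered. *)
Lemma tiling_half_open S x : is_tiling Q S ->
  (\esum_(l in S) (\1_Q' (x - l)%R : R)%:E = 1)%E.
Proof.
move=> tS; have sS := tiling_separated tS.
apply/eqP; rewrite eq_le; apply/andP; split.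
  apply: packing_le1 => // u v i uQ vQ.
  by have := uQ i; have := vQ i; rewrite ltr_norml; lra.
suff [l [Sl xl]] : exists l, S l /\ Q' (x - l).
  have := @sum_seq_le_esum _ _ S (fun l => (\1_Q' (x - l)%R : R)%:E) [:: l] isT.
  by rewrite big_seq1 indicE mem_set//; apply => i; rewrite inE => /eqP ->.
apply/not_existsP => H.
pose P l (e : R) := forall y, (forall i, x ord0 i < y ord0 i < x ord0 i + e) -> ~ Q (y - l).
have Pl l : S l -> exists2 e, 0 < e & P l e.
  move=> Sl; have : ~ Q' (x - l) by move=> xl; apply: (H l).
  (* Below the cube there is a positive gap to stay within; at or above its upper face, moving up
     keeps outside and any size will do. *)
  move=> /existsNP[i /negP]; rewrite !mxE negb_and -ltNge -leNgt => /orP[h|h].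
    exists (- 2^-1 - (x ord0 i - l ord0 i)); first by rewrite subr_gt0.
    by move=> y xy /(_ i); have := xy i; rewrite !mxE; lra.
  exists 1 => // y xy /(_ i); have := xy i; rewrite !mxE; lra.
(* A cube meeting a box of side at most 1 at [x] has its centre within 3/2 of [x] in each
   coordinate, so radius 2 leaves finitely many cubes to avoid. *)
have := @separated_near_finite S x 2 sS.
set A := [set l | _] => fA.
have [e e0 eP] : exists2 e, 0 < e & forall l, A l -> P l e.
  suff : forall s : seq 'rV[R]_n, (forall l, l \in s -> S l) ->
      exists2 e, 0 < e & forall l, l \in s -> P l e.
    move=> /(_ (finmap.enum_fset (fset_set A))); case.
      by move=> l; rewrite in_fset_set// inE => -[].
    by move=> e e0 eP; exists e => // l Al; apply: eP; rewrite in_fset_set// inE.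
  elim=> [|l s IH] sS'; first by exists 1.
  have [e e0 eP] := Pl l (sS' l (mem_head _ _)).
  have [i si|e' e'0 e'P] := IH; first by apply: sS'; rewrite inE si orbT.
  exists (Num.min e e'); first by rewrite lt_min e0.
  move=> k; rewrite inE => /predU1P[->|ks] y xy.
    by apply: eP => i; have := xy i; case: (leP e e') => h; lra.
  by apply: (e'P k ks) => i; have := xy i; case: (leP e e') => h; lra.
pose c : 'rV[R]_n := \row_i (x ord0 i + Num.min e 1).
have [i|y [xyc Fy]] := @ae_box _ x c tS.
  by rewrite mxE ltrDl lt_min e0 ltr01.
have [l [Sl yl]] : exists l, S l /\ Q (y - l).
  apply/not_existsP => K; have : (\esum_(l in S) (\1_Q (y - l)%R : R)%:E = 0)%E.
    by rewrite esum1// => l Sl; rewrite indicE memNset// => yl; apply: (K l).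
  by rewrite Fy => -[] /eqP; rewrite oner_eq0.
apply: (eP l _ y _ yl).
  split => // i; have := yl i; have := xyc i; rewrite !mxE ler_norml.
  by case: (leP e 1) => h; lra.
move=> i; have := xyc i; rewrite !mxE.
by case: (leP e 1) => h; lra.
Qed.

End tilings.

(** * Coordinatewise exchange of the interval indicator for the squared sinc *)

Section exchange.
Context {R : realType} {n : nat}.
Local Notation Q := (@open_unit_cube R n).
Local Notation Q' := (@half_open_cube R n).
Implicit Types (u v x y : 'rV[R]_n) (S : set 'rV[R]_n).
Local Notation I := (`[- 2^-1, 2^-1[%classic : set R).

(* The factor of coordinate [i] once the first [k] coordinates have been exchanged. *)
Let profile (k : nat) (i : 'I_n) (t : R) : R :=
  if (i < k)%N then sinc t ^+ 2 else \1_I t.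

Lemma profile_ge0 k i t : 0 <= profile k i t.
Proof. by rewrite /profile; case: ifP => _; rewrite ?sqr_ge0// indicE. Qed.

(** Freeze all coordinates but [j]: the remaining factors are weights [w l] at the points
    [l ord0 j]. Varying coordinate [j] in the hypothesis gives unit windows, and [window_sum]
    applies to the squared sinc. *)
Lemma exchange_step S k : countable S -> (k < n)%N ->
  (forall x, (\esum_(l in S) (\prod_i profile k i (x ord0 i - l ord0 i))%:E = 1)%E) ->
  forall x, (\esum_(l in S) (\prod_i profile k.+1 i (x ord0 i - l ord0 i))%:E = 1)%E.
Proof.
move=> cS kn Hk x; pose j := Ordinal kn.
pose w (l : 'rV[R]_n) := \prod_(i | i != j) profile k i (x ord0 i - l ord0 i).
have w0 l : 0 <= w l by apply: prodr_ge0 => i _; exact: profile_ge0.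
have window t : mass S (fun l => l ord0 j) w `]t, (t + 1)] = 1%E.
  (* With [t + 1/2] in place [j], the indicator of [-1/2, 1/2) selects exactly the [l] with
     [l ord0 j] in []t, t + 1]]. *)
  pose y : 'rV[R]_n := \row_i (if i == j then t + 2^-1 else x ord0 i).
  rewrite -(Hk y) /mass (_ : [set l | _] = S `&` [set l | `]t, (t + 1)]%classic (l ord0 j)])//.
  rewrite esum_mkcondr; apply: eq_esum => l Sl.
  rewrite (bigD1 j)//= mxE eqxx {1}/profile ltnn.
  have -> : \prod_(i | i != j) profile k i (y ord0 i - l ord0 i) = w l.
    by apply: eq_bigr => i ij; rewrite mxE (negPf ij).
  have -> : (l \in [set l : 'rV[R]_n | `]t, (t + 1)]%classic (l ord0 j)]) =
      (t + 2^-1 - l ord0 j \in I).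
    by apply/idP/idP; rewrite !inE/= !in_itv/=; lra.
  by rewrite indicE; case: (_ \in I); rewrite ?mul1r ?mul0r.
have := window_sum cS w0 window (h := fun t => sinc t ^+ 2) (fun t => sqr_ge0 _)
  sinc_parseval (x ord0 j).
move=> <-; apply: eq_esum => l _; congr _%:E.
rewrite (bigD1 j)//= /profile ltnSn mulrC; congr (_ * _).
apply: eq_bigr => i ij; rewrite /profile ltnS leq_eqVlt.
rewrite (_ : (i == k :> nat) = false)//; apply/negP => /eqP ik.
by move/eqP: ij; apply; exact: val_inj.
Qed.

(** [k = 0] is the exact half-open tiling and [k = n] the Parseval identity. *)
Lemma tiling_parseval S : is_tiling Q S ->
  forall v, (\esum_(l in S) (cube_sinc (v - l)%R ^+ 2)%:E = 1)%E.
Proof.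
move=> tS; have cS := separated_countable (tiling_separated tS).
have H k : (k <= n)%N ->
    forall x, (\esum_(l in S) (\prod_i profile k i (x ord0 i - l ord0 i))%:E = 1)%E.
  elim: k => [_ x|k IH kn]; last by apply: exchange_step => //; exact/IH/ltnW.
  rewrite -(tiling_half_open x tS); apply: eq_esum => l _; congr _%:E.
  rewrite [RHS]indicE; have [xl|xl] := boolP (x - l \in Q').
    rewrite big1// => i _; rewrite /profile/= indicE mem_set//= in_itv/=.
    by move: xl; rewrite inE => /(_ i); rewrite !mxE.
  have /existsNP[i /negP xli] : ~ Q' (x - l) by move=> ?; move/negP: xl; apply; rewrite inE.
  rewrite (bigD1 i)//= /profile/= indicE memNset ?mul0r//= in_itv/=.
  by move: xli; rewrite !mxE => /negP.
move=> v; rewrite -(H n (leqnn n) v); apply: eq_esum => l _; congr _%:E.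
rewrite /cube_sinc -prodrXl; apply: eq_bigr => i _.
by rewrite /profile ltn_ord !mxE.
Qed.

End exchange.

Theorem corollary1 (R : realType) (d : nat) (Lambda : set 'rV[R]_d)
    (Lambda_discrete : discrete_set Lambda) :
  is_spectrum open_unit_cube Lambda <-> is_tiling open_unit_cube Lambda.
Proof.
by split=> [/is_spectrumP/parseval_tiling|/tiling_parseval/is_spectrumP].
Qed.
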